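(* For each $n$, let $p=p_n>q$ and let $\mathbf{y}=\mathbf{X}\boldsymbol{\beta}^\star+\boldsymbol{\epsilon}$, where the rows of $\mathbf{X}\in\mathbb{R}^{n\times p_n}$ are i.i.d. $\mathcal{N}(0,\boldsymbol{\Sigma})$ with $\boldsymbol{\Sigma}\in\mathbb{R}^{p_n\times p_n}$ symmetric positive definite, $\boldsymbol{\epsilon}\sim\mathcal{N}(0,\sigma^2\mathbb{I}_n)$ ($\sigma>0$) is independent of $\mathbf{X}$, and $\boldsymbol{\beta}^\star=(\boldsymbol{\beta}_1^{\star\prime},\mathbf{0}')'$ with $\boldsymbol{\beta}_1^\star\in\mathbb{R}^q$ fixed and having all entries nonzero. Let $\boldsymbol{\beta}_{\min}=\min_{1\le j\le q}|(\boldsymbol{\beta}_1^\star)_j|$. Assume $p_n e^{-n^{\delta}}\to 0$ as $n\to\infty$ for every $\delta>0$. Assume there exist positive constants $M_1,M_2,M_3,\alpha$ with $$M_1<\frac{\boldsymbol{\beta}_{\min}^2}{9\sigma^2},\qquad \frac{\sqrt{2+\sqrt{2}}\sqrt{M_3}\,\sigma}{\alpha}<\frac{\boldsymbol{\beta}_{\min}}{3M_2\sqrt{q}},$$ and that there exist $\lambda=\lambda_n>0$, $\eta=\eta_n>0$ such that for all sufficiently large $n$: $$\frac{\lambda}{n}<\frac{2\boldsymbol{\beta}_{\min}}{3M_2\sqrt{q}},\qquad \frac{\lambda}{n}\ge\frac{2\sqrt{2+\sqrt{2}}\sqrt{M_3}\,\sigma}{\alpha},\qquad \frac{\eta}{n}<\frac{1}{3M_2\lambda_{\max}(\boldsymbol{\Sigma}_{11})}\cdot\frac{\boldsymbol{\beta}_{\min}}{\|\boldsymbol{\beta}_1^\star\|_2},$$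 and the Generalized Irrepresentable Condition holds: there is $\delta_4>0$ such that $$\max_{1\le j\le p_n-q}\mathbb{P}\left(\left|\left(\mathcal{C}_{21}^{n,\boldsymbol{\Sigma}}\left(\mathcal{C}_{11}^{n,\boldsymbol{\Sigma}}\right)^{-1}\left(\mathrm{sign}(\boldsymbol{\beta}_1^\star)+\frac{2\eta}{\lambda}\boldsymbol{\Sigma}_{11}\boldsymbol{\beta}_1^\star\right)-\frac{2\eta}{\lambda}\boldsymbol{\Sigma}_{21}\boldsymbol{\beta}_1^\star\right)_j\right|> 1-\alpha\right)=o\left(e^{-n^{\delta_4}}\right).$$ Suppose also that there exist $\delta_1,\delta_2,\delta_3>0$ such that, as $n\to\infty$, $$\mathbb{P}(\lambda_{\max}(H_AH_A')\le M_1)=1-o(e^{-n^{\delta_1}}),\quad \mathbb{P}\big(\lambda_{\max}((\mathcal{C}_{11}^{n,\boldsymbol{\Sigma}})^{-1})\le M_2\big)=1-o(e^{-n^{\delta_2}}),\quad \mathbb{P}(\lambda_{\max}(H_BH_B')\le M_3)=1-o(e^{-n^{\delta_3}}),$$ where $H_A=n^{-1/2}(\mathcal{C}_{11}^{n,\boldsymbol{\Sigma}})^{-1}\mathbf{X}_1'$ and $H_B=n^{-1/2}\big(\mathcal{C}_{21}^{n,\boldsymbol{\Sigma}}(\mathcal{C}_{11}^{n,\boldsymbol{\Sigma}})^{-1}\mathbf{X}_1'-\mathbf{X}_2'\big)$. Then $$\mathbb{P}\left(\mathrm{sign}(\widehat{\boldsymbol{\beta}})=\mathrm{sign}(\boldsymbol{\beta}^\star)\right)\to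 1\quad\text{as } n\to\infty,$$ where $\widehat{\boldsymbol{\beta}}$ is the generalized Elastic Net estimator with parameters $\lambda_n,\eta_n$.
   Context: Notation: $\boldsymbol{\Sigma}=\boldsymbol{U}\boldsymbol{D}\boldsymbol{U}'$ is the spectral decomposition, $\boldsymbol{\Sigma}^{1/2}=\boldsymbol{U}\boldsymbol{D}^{1/2}\boldsymbol{U}'$, $\boldsymbol{\Sigma}^{-1/2}=\boldsymbol{U}\boldsymbol{D}^{-1/2}\boldsymbol{U}'$, and $\widetilde{\mathbf{X}}=\mathbf{X}\boldsymbol{\Sigma}^{-1/2}$. The generalized Elastic Net (gEN) estimator is $\widehat{\boldsymbol{\beta}}=\boldsymbol{\Sigma}^{-1/2}\widehat{\widetilde{\boldsymbol{\beta}}}$, where $\widehat{\widetilde{\boldsymbol{\beta}}}$ is the (unique) minimizer over $\widetilde{\boldsymbol{\beta}}\in\mathbb{R}^p$ of $$\|\mathbf{y}-\widetilde{\mathbf{X}}\widetilde{\boldsymbol{\beta}}\|_2^2+\lambda\|\boldsymbol{\Sigma}^{-1/2}\widetilde{\boldsymbol{\beta}}\|_1+\eta\|\widetilde{\boldsymbol{\beta}}\|_2^2.$$ $\mathbf{X}_1$ (resp. $\mathbf{X}_2$) denotes the first $q$ (resp. last $p-q$) columns of $\mathbf{X}$; $C_n=n^{-1}\mathbf{X}'\mathbf{X}$ with blocks $C_{ij}^n=n^{-1}\mathbf{X}_i'\mathbf{X}_j$; $\boldsymbol{\Sigma}_{ij}$ are the corresponding blocks of $\boldsymbol{\Sigma}$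 ($\boldsymbol{\Sigma}_{11}$ is $q\times q$). Define $\mathcal{C}_{11}^{n,\boldsymbol{\Sigma}}=C_{11}^n+\frac{\eta}{n}\boldsymbol{\Sigma}_{11}$, $\mathcal{C}_{21}^{n,\boldsymbol{\Sigma}}=C_{21}^n+\frac{\eta}{n}\boldsymbol{\Sigma}_{21}$. $\lambda_{\max}(A)$ is the largest eigenvalue of a symmetric matrix $A$. $\mathrm{sign}(x)=1,-1,0$ for $x>0,x<0,x=0$, applied componentwise. *)

(* Defs.v *)
From HB Require Import structures.
From mathcomp Require Import all_boot all_order all_algebra.
From mathcomp Require Import all_classical all_reals all_analysis.
Set Implicit Arguments. Unset Strict Implicit. Unset Printing Implicit Defensive.
Import Order.TTheory GRing.Theory Num.Theory.
Import numFieldNormedType.Exports.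
Local Open Scope classical_set_scope.
Local Open Scope ring_scope.

Section defs.
Context {R : realType}.

Definition pr d (T : measurableType d) (P : probability T R) (A : set T) : R :=
  fine (P A).

(* multivariate normal N(mu, K) for a random row vector, K positive definite:
   every nonzero linear combination a'Z is univariate normal with mean a'mu
   and standard deviation sqrt(a'Ka) *)
Definition is_normal_vec d (T : measurableType d) (P : probability T R) k
    (Z : T -> 'rV[R]_k) (mu : 'rV[R]_k) (K : 'M[R]_k) : Prop :=
  (forall j, measurable_fun setT (fun w => Z w 0 j)) /\
  forall a : 'rV[R]_k, a != 0 -> forall A : set R, measurable A ->
    P ((fun w => (Z w *m a^T) 0 0) @^-1` A) =
    normal_prob ((mu *m a^T) 0 0) (Num.sqrt ((a *m K *m a^T) 0 0)) A.

(* mutual independence of the blocks of a finite family of real random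
   variables f t (t : Tc), block of t being b t : the joint law of all the
   coordinates is the product of the joint laws of the blocks
   (tested on measurable rectangles, which generate the product sigma-algebra) *)
Definition indep_blocks d (T : measurableType d) (P : probability T R)
    (I Tc : finType) (b : Tc -> I) (f : Tc -> T -> R) : Prop :=
  (forall t, measurable_fun setT (f t)) /\
  forall B : Tc -> set R, (forall t, measurable (B t)) ->
    pr P (\bigcap_(t in [set: Tc]) (f t @^-1` B t)) =
    \prod_(i : I) pr P (\bigcap_(t in [set t | b t = i]) (f t @^-1` B t)).

Definition Xeps_block n p (t : ('I_n * 'I_p) + 'I_n) : option 'I_n :=
  match t with inl ij => Some ij.1 | inr _ => None end.
Definition Xeps_coord d (T : measurableType d) n p
    (X : T -> 'M[R]_(n, p)) (eps : T -> 'cV[R]_n)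
    (t : ('I_n * 'I_p) + 'I_n) (w : T) : R :=
  match t with inl ij => X w ij.1 ij.2 | inr k => eps w k 0 end.

Definition sgv m n (A : 'M[R]_(m, n)) : 'M[R]_(m, n) := map_mx (@Num.sg _) A.
Definition norm2sq n (v : 'cV[R]_n) : R := \sum_i v i 0 ^+ 2.
Definition norm2 n (v : 'cV[R]_n) : R := Num.sqrt (norm2sq v).
Definition norm1 n (v : 'cV[R]_n) : R := \sum_i `|v i 0|.

Definition sym_pd n (S : 'M[R]_n) : Prop :=
  S^T = S /\ forall v : 'cV[R]_n, v != 0 -> 0 < (v^T *m S *m v) 0 0.

Definition lambda_max n (A : 'M[R]_n) : R := sup [set a : R | eigenvalue A a].

Definition inv_sqrtmx n (S : 'M[R]_n) : 'M[R]_n :=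
  xget 0 [set T | exists (U : 'M[R]_n) (dg : 'rV[R]_n),
    [/\ U *m U^T = 1%:M, forall i, 0 < dg 0 i, S = U *m diag_mx dg *m U^T &
        T = U *m diag_mx (map_mx (fun x => (Num.sqrt x)^-1) dg) *m U^T]].

Definition gEN_obj n p (X : 'M[R]_(n, p)) (y : 'cV[R]_n) (S : 'M[R]_p)
    (lam eta : R) (bt : 'cV[R]_p) : R :=
  norm2sq (y - (X *m inv_sqrtmx S) *m bt) + lam * norm1 (inv_sqrtmx S *m bt)
  + eta * norm2sq bt.
Definition gEN_tilde n p (X : 'M[R]_(n, p)) (y : 'cV[R]_n) (S : 'M[R]_p)
    (lam eta : R) : 'cV[R]_p :=
  xget 0 [set bt | forall b, gEN_obj X y S lam eta bt <= gEN_obj X y S lam eta b].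
Definition gEN n p (X : 'M[R]_(n, p)) (y : 'cV[R]_n) (S : 'M[R]_p)
    (lam eta : R) : 'cV[R]_p :=
  inv_sqrtmx S *m gEN_tilde X y S lam eta.

Definition Cn11 n q r (X : 'M[R]_(n, q + r)) (S : 'M[R]_(q + r)) (eta : R)
  : 'M[R]_q :=
  (n%:R^-1 *: ((lsubmx X)^T *m lsubmx X)) + (eta / n%:R) *: ulsubmx S.
Definition Cn21 n q r (X : 'M[R]_(n, q + r)) (S : 'M[R]_(q + r)) (eta : R)
  : 'M[R]_(r, q) :=
  (n%:R^-1 *: ((rsubmx X)^T *m lsubmx X)) + (eta / n%:R) *: dlsubmx S.
Definition HA n q r (X : 'M[R]_(n, q + r)) S eta : 'M[R]_(q, n) :=
  (Num.sqrt n%:R)^-1 *: (invmx (Cn11 X S eta) *m (lsubmx X)^T).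
Definition HB n q r (X : 'M[R]_(n, q + r)) S eta : 'M[R]_(r, n) :=
  (Num.sqrt n%:R)^-1 *:
    (Cn21 X S eta *m invmx (Cn11 X S eta) *m (lsubmx X)^T - (rsubmx X)^T).
Definition GIC_vec n q r (X : 'M[R]_(n, q + r)) (S : 'M[R]_(q + r))
    (lam eta : R) (b1 : 'cV[R]_q) : 'cV[R]_r :=
  Cn21 X S eta *m invmx (Cn11 X S eta) *m
     (sgv b1 + (2 * eta / lam) *: (ulsubmx S *m b1))
  - (2 * eta / lam) *: (dlsubmx S *m b1).

End defs.

(* beta_min = min_j |b_j|; the seed norm1 b >= every |b_j|, so for q >= 1 this
   is exactly the minimum over the q entries *)
Definition beta_min {R : realType} q (b : 'cV[R]_q) : R :=
  \big[Order.min/norm1 b]_(j < q) `|b j 0|.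

(* Main.v *)
Require Import Defs.
From HB Require Import structures.
From mathcomp Require Import all_boot all_order all_algebra.
From mathcomp Require Import all_classical all_reals all_analysis.
From mathcomp Require Import measurable_realfun ring lra.
Set Implicit Arguments. Unset Strict Implicit. Unset Printing Implicit Defensive.
Import Order.TTheory GRing.Theory Num.Theory.
Import numFieldNormedType.Exports.
Local Open Scope classical_set_scope.
Local Open Scope ring_scope.

(** With [C = Cn11] and [s = sign(beta1)], the Karush-Kuhn-Tucker conditions
    say that the estimator has the right signs iff the vector
      [b = beta1 + n^-1/2 HA eps - C^-1 (lam/(2n) s + (eta/n) S11 beta1)]
    has sign [s] and the inactive coordinates of the score, which are those of
    [lam/2 GIC - n^1/2 HB eps], are at most [lam/2] in absolute value.
    By Cauchy-Schwarz, [(H eps)_j^2 <= lambda_max(H H') |eps|^2] for [H = HA, HB],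
    so all the noise terms are controlled at once by the single event
    [|eps|^2 < n K sigma^2], where [K > 1] is allowed by the strict inequality
    on [M1] and by [2 + sqrt 2 > 1]. Its probability tends to 1 by Chebyshev's
    inequality and the fourth moments of the Gaussian. The two remaining terms
    of [b - beta1] are bounded through operator norms, and the irrepresentable
    condition is used with a union bound over the [p_n] coordinates. *)

(** * Quadratic forms and the largest eigenvalue *)

Section quadratic_forms.
Context {R : realType}.
Implicit Types n m : nat.

(** Measurability is the obstacle that shapes the development. Monotonicity and union bounds apply
    to measurable events, whereas [lambda_max] is a supremum and the estimator comes out of a choice
    operator. Eigenvalue bounds are therefore rewritten as countably many inequalities between
    quadratic forms, inverses as cofactors over determinants, and sign recovery through an explicit
    vector. The choice operators also have default values: [inv_sqrtmx] becomes meaningful through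
    the spectral theorem, and a minimizer has to be exhibited or the default excluded. As for the
    constants, [beta_min] is split into thirds between the noise, the l1 bias and the ridge bias;
    this is the origin of the 9 in the bound on [M1] and of the 3 in those on [lam] and [eta]. *)

Definition bform n (A : 'M[R]_n) (u v : 'cV[R]_n) : R := (u^T *m A *m v) 0 0.

Lemma bformE n (A : 'M[R]_n) u v :
  bform A u v = \sum_i \sum_j u i 0 * A i j * v j 0.
Proof.
rewrite /bform mxE exchange_big /=; apply: eq_bigr => j _.
by rewrite mxE mulr_suml; apply: eq_bigr => i _; rewrite mxE.
Qed.

Lemma bformDl n (A : 'M[R]_n) u1 u2 v :
  bform A (u1 + u2) v = bform A u1 v + bform A u2 v.
Proof. by rewrite /bform linearD /= !mulmxDl mxE. Qed.

Lemma bformDr n (A : 'M[R]_n) u v1 v2 :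
  bform A u (v1 + v2) = bform A u v1 + bform A u v2.
Proof. by rewrite /bform mulmxDr mxE. Qed.

Lemma bformZl n (A : 'M[R]_n) a u v : bform A (a *: u) v = a * bform A u v.
Proof. by rewrite /bform linearZ /= -!scalemxAl mxE. Qed.

Lemma bformZr n (A : 'M[R]_n) a u v : bform A u (a *: v) = a * bform A u v.
Proof. by rewrite /bform -scalemxAr mxE. Qed.

Lemma bform_sym n (A : 'M[R]_n) u v : A^T = A -> bform A u v = bform A v u.
Proof.
move=> sA; rewrite /bform -[in LHS](trmxK (u^T *m A *m v)) mxE.
by rewrite !trmx_mul trmxK sA mulmxA.
Qed.

Lemma bform_addm n (A B : 'M[R]_n) u v :
  bform (A + B) u v = bform A u v + bform B u v.
Proof. by rewrite /bform mulmxDr mulmxDl mxE. Qed.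

Lemma bform_scalem n a (A : 'M[R]_n) u v : bform (a *: A) u v = a * bform A u v.
Proof. by rewrite /bform -scalemxAr -scalemxAl mxE. Qed.

Lemma norm2sqE n (v : 'cV[R]_n) : norm2sq v = bform 1%:M v v.
Proof.
by rewrite /bform mulmx1 mxE; apply: eq_bigr => i _; rewrite mxE expr2.
Qed.

Lemma bform_scalar n a (v : 'cV[R]_n) : bform a%:M v v = a * norm2sq v.
Proof. by rewrite -scalemx1 bform_scalem norm2sqE. Qed.

Lemma bform_gram m n (B : 'M[R]_(m, n)) (v : 'cV[R]_n) :
  bform (B^T *m B) v v = norm2sq (B *m v).
Proof. by rewrite norm2sqE /bform mulmx1 trmx_mul !mulmxA. Qed.

Lemma norm2sq_ge0 n (v : 'cV[R]_n) : 0 <= norm2sq v.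
Proof. by apply: sumr_ge0 => i _; exact: sqr_ge0. Qed.

Lemma norm2sq_eq0 n (v : 'cV[R]_n) : (norm2sq v == 0) = (v == 0).
Proof.
apply/idP/eqP => [|->]; last first.
  by rewrite /norm2sq big1// => i _; rewrite mxE expr0n.
rewrite psumr_eq0 => [/allP h|i _]; last exact: sqr_ge0.
apply/colP => i; rewrite mxE; apply/eqP.
by have := h i (mem_index_enum i); rewrite sqrf_eq0.
Qed.

Lemma norm2sqZ n a (v : 'cV[R]_n) : norm2sq (a *: v) = a ^+ 2 * norm2sq v.
Proof. by rewrite mulr_sumr; apply: eq_bigr => i _; rewrite mxE exprMn. Qed.

Lemma norm2sq_coord n (v : 'cV[R]_n) i : v i 0 ^+ 2 <= norm2sq v.
Proof.
by rewrite /norm2sq (bigD1 i)//= lerDl; apply: sumr_ge0 => j _; exact: sqr_ge0.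
Qed.

Definition psdmx n (A : 'M[R]_n) : Prop := A^T = A /\ forall v, 0 <= bform A v v.

(** The polynomial is evaluated at its minimizer [- b / c]. If [c = 0] and [b != 0], it is affine
    and takes the value [-1] at the point chosen, which is impossible. *)
Lemma quadratic_ge0_discr (a b c : R) : 0 <= c ->
  (forall t, 0 <= a + 2 * b * t + c * t ^+ 2) -> b ^+ 2 <= a * c.
Proof.
move=> c0 h; have [c_eq0|c_neq0] := eqVneq c 0.
  have [->|b0] := eqVneq b 0; first by rewrite c_eq0 expr0n/= mulr0.
  have := h (- (a + 1) / (2 * b)); rewrite c_eq0 mul0r addr0.
  have -> : a + 2 * b * (- (a + 1) / (2 * b)) = -1 by field; rewrite b0.
  by rewrite lerNr oppr0 ler10.
have cp : 0 < c by rewrite lt_def c_neq0.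
have := h (- b / c).
have -> : a + 2 * b * (- b / c) + c * (- b / c) ^+ 2 = (a * c - b ^+ 2) / c by field.
by rewrite pmulr_lge0 ?invr_gt0// subr_ge0.
Qed.

Lemma psd_cauchy_schwarz n (A : 'M[R]_n) u v : psdmx A ->
  bform A u v ^+ 2 <= bform A u u * bform A v v.
Proof.
move=> [sA pA]; apply: quadratic_ge0_discr => // t.
have := pA (u + t *: v).
rewrite !bformDl !bformDr !bformZl !bformZr (bform_sym v u sA).
by congr (0 <= _); ring.
Qed.

Lemma psd1 n : psdmx (1%:M : 'M[R]_n).
Proof. by split=> [|v]; rewrite ?trmx1// -norm2sqE norm2sq_ge0. Qed.

Lemma mulmx_cauchy_schwarz m n (B : 'M[R]_(m, n)) (v : 'cV[R]_n) i :
  (B *m v) i 0 ^+ 2 <= (B *m B^T) i i * norm2sq v.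
Proof.
have := psd_cauchy_schwarz (row i B)^T v (psd1 n).
rewrite -!norm2sqE /bform mulmx1 trmxK -row_mul mxE => /le_trans; apply.
rewrite le_eqVlt; apply/orP; left; apply/eqP; congr (_ * _).
by rewrite mxE; apply: eq_bigr => j _; rewrite !mxE expr2.
Qed.

(** Cauchy-Schwarz for the form [A] at the pair [A v], [v] gives |A v|^4 <= A(A v, A v) A(v, v) <= M
    |A v|^2 A(v, v), and |A v|^2 cancels. *)
Lemma psd_norm_mulmx n (A : 'M[R]_n) M v : psdmx A -> 0 <= M ->
  (forall u, bform A u u <= M * norm2sq u) ->
  norm2sq (A *m v) <= M * bform A v v.
Proof.
move=> pA M0 h; have [sA A0] := pA.
have := psd_cauchy_schwarz (A *m v) v pA.
have -> : bform A (A *m v) v = norm2sq (A *m v).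
  by rewrite norm2sqE /bform mulmx1 -!mulmxA.
have [->|N0] := eqVneq (norm2sq (A *m v)) 0; first by rewrite mulr_ge0.
have Np : 0 < norm2sq (A *m v) by rewrite lt_def N0 norm2sq_ge0.
move=> /le_trans/(_ (ler_wpM2r (A0 v) (h _))).
by rewrite expr2 -mulrA mulrCA ler_pM2l.
Qed.

Lemma psd_norm_mulmx_le n (A : 'M[R]_n) M v : psdmx A -> 0 <= M ->
  (forall u, bform A u u <= M * norm2sq u) ->
  norm2sq (A *m v) <= M ^+ 2 * norm2sq v.
Proof.
move=> pA M0 h; apply: le_trans (psd_norm_mulmx v pA M0 h) _.
by rewrite expr2 -mulrA ler_wpM2l.
Qed.

(** A crude substitute for the operator norm: wherever it is used, only some finite constant
    matters. *)
Definition abs_sum m n (A : 'M[R]_(m, n)) : R := \sum_i \sum_j `|A i j|.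

Lemma abs_sum_ge0 m n (A : 'M[R]_(m, n)) : 0 <= abs_sum A.
Proof. by apply: sumr_ge0 => i _; apply: sumr_ge0. Qed.

Lemma bform_abs_le n (A : 'M[R]_n) (u v : 'cV[R]_n) c : (forall i j, `|u i 0 * v j 0| <= c) ->
  `|bform A u v| <= abs_sum A * c.
Proof.
move=> h; rewrite bformE (le_trans (ler_norm_sum _ _ _))// mulr_suml.
apply: ler_sum => i _; rewrite (le_trans (ler_norm_sum _ _ _))// mulr_suml.
apply: ler_sum => j _; rewrite mulrAC normrM mulrC ler_wpM2l//.
Qed.

Lemma bform_le_norm2sq n (A : 'M[R]_n) v : `|bform A v v| <= abs_sum A * norm2sq v.
Proof.
apply: bform_abs_le => i j.
have hi := norm2sq_coord v i; have hj := norm2sq_coord v j.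
by rewrite ler_norml; apply/andP; split; nra.
Qed.

(** With [G] the Gram matrix of the inverse of [B], |v|^2 is the quadratic form of [G] at [B v]. *)
Lemma unitmx_norm2sq_le n (B : 'M[R]_n) : B \in unitmx ->
  exists2 c, 0 <= c & forall v, norm2sq v <= c * norm2sq (B *m v).
Proof.
move=> uB; pose G := (invmx B)^T *m invmx B; exists (abs_sum G).
  exact: abs_sum_ge0.
move=> v; have <- : bform G (B *m v) (B *m v) = norm2sq v.
  by rewrite bform_gram mulKmx.
exact: le_trans (ler_norm _) (bform_le_norm2sq _ _).
Qed.

(* No compactness is needed: with [s] the supremum of the Rayleigh quotients,
   [B = s I - A] is positive semidefinite, so [|B v|^2 <= k (v' B v)]; if [B]
   were invertible, [v' B v] would be bounded below on the unit sphere, which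
   contradicts the choice of [s]. *)
Lemma exists_top_eigenvalue n (A : 'M[R]_n) : (0 < n)%N -> A^T = A ->
  exists2 s, eigenvalue A s & forall v, bform A v v <= s * norm2sq v.
Proof.
move=> n0 sA; pose E := [set x | exists2 v, norm2sq v = 1 & x = bform A v v].
have E0 : E !=set0.
  exists (bform A (delta_mx (Ordinal n0) 0) (delta_mx (Ordinal n0) 0)).
  exists (delta_mx (Ordinal n0) 0) => //.
  by rewrite norm2sqE /bform mulmx1 trmx_delta mul_delta_mx mxE !eqxx.
have Eub : has_ubound E.
  exists (abs_sum A) => _ [v v1 ->]; apply: le_trans (ler_norm _) _.
  by have := bform_le_norm2sq A v; rewrite v1 mulr1.
pose s := sup E.
have As v : bform A v v <= s * norm2sq v.
  have [/eqP|v0] := eqVneq (norm2sq v) 0.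
    rewrite norm2sq_eq0 => /eqP->; rewrite /bform mulmx0 mxE.
    by rewrite /norm2sq big1 ?mulr0// => i _; rewrite mxE expr0n.
  have vp : 0 < norm2sq v by rewrite lt_def v0 norm2sq_ge0.
  pose r := (Num.sqrt (norm2sq v))^-1.
  have r2 : r ^+ 2 = (norm2sq v)^-1 by rewrite exprVn sqr_sqrtr// ltW.
  have : E (bform A (r *: v) (r *: v)).
    by exists (r *: v) => //; rewrite norm2sqZ r2 mulVf.
  move=> /(ub_le_sup Eub); rewrite bformZl bformZr mulrA -expr2 r2.
  by rewrite ler_pdivrMl// mulrC.
exists s => //; pose B := s%:M - A.
have BE v : bform B v v = s * norm2sq v - bform A v v.
  by rewrite bform_addm bform_scalar -scaleN1r bform_scalem mulN1r.
have pB : psdmx B.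
  split=> [|v]; last by rewrite BE subr_ge0.
  by rewrite linearB/= tr_scalar_mx sA.
have [uB|] := boolP (B \in unitmx); last first.
  rewrite -row_free_unit -kermx_eq0 => /rowV0Pn[v /sub_kermxP vB v0].
  apply/eigenvalueP; exists v => //; apply/esym/eqP.
  by rewrite -subr_eq0 -mul_mx_scalar -mulmxBr vB.
have [c c0 hc] := unitmx_norm2sq_le uB.
pose k := abs_sum B; have k0 : 0 <= k := abs_sum_ge0 B.
have hk u : bform B u u <= k * norm2sq u.
  by apply: le_trans (ler_norm _) (bform_le_norm2sq _ _).
have gap v : norm2sq v = 1 -> 1 <= c * k * (s - bform A v v).
  move=> v1; rewrite -{1}v1 (le_trans (hc v))// -mulrA ler_wpM2l//.
  by rewrite -[s]mulr1 -v1 -BE psd_norm_mulmx.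
have ck : 0 < c * k.
  have [_ [v v1 _]] := E0; have := gap v v1.
  have := As v; rewrite v1 mulr1 => h1 h2.
  rewrite lt_def mulr_ge0// andbT; apply: contraTneq h2 => ->.
  by rewrite mul0r -ltNge ltr01.
have : s <= s - (c * k)^-1.
  apply: ge_sup => // _ [v v1 ->]; have := gap v v1.
  by rewrite -ler_pdivrMl// mulr1; lra.
by rewrite lerDl oppr_ge0 leNgt invr_gt0 ck.
Qed.

Lemma eigenvalue_le n (A : 'M[R]_n) M a :
  (forall v, bform A v v <= M * norm2sq v) -> eigenvalue A a -> a <= M.
Proof.
move=> h /eigenvalueP[v vA v0]; have := h v^T.
have vp : 0 < norm2sq v^T.
  by rewrite lt_def norm2sq_ge0 norm2sq_eq0 trmx_eq0 v0.
have -> : bform A v^T v^T = a * norm2sq v^T.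
  by rewrite norm2sqE /bform trmxK vA mulmx1 -scalemxAl mxE.
by rewrite ler_pM2r.
Qed.

(** The supremum defining [lambda_max] is attained, at the top of the Rayleigh quotients. Every
    spectral hypothesis is used through this equivalence. In size 0 it would fail for negative [M]:
    there is no eigenvalue and the supremum defaults to 0. *)
Lemma lambda_max_leP n (A : 'M[R]_n) M : (0 < n)%N -> A^T = A ->
  lambda_max A <= M <-> forall v, bform A v v <= M * norm2sq v.
Proof.
move=> n0 sA; have [s es hs] := exists_top_eigenvalue n0 sA.
have -> : lambda_max A = s.
  apply/eqP; rewrite eq_le; apply/andP; split.
    by apply: ge_sup; [exists s|move=> a /eigenvalue_le; exact].
  by apply: ub_le_sup => //; exists s => a /eigenvalue_le; exact.
split=> [sM v|]; last by move/eigenvalue_le; exact.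
by rewrite (le_trans (hs v))// ler_wpM2r// norm2sq_ge0.
Qed.

Lemma bform_lambda_max n (A : 'M[R]_n) v : (0 < n)%N -> A^T = A ->
  bform A v v <= lambda_max A * norm2sq v.
Proof. by move=> n0 sA; exact: (lambda_max_leP _ n0 sA).1. Qed.

(* the reflection across the hyperplane orthogonal to [e_0 - v] *)
Lemma householder n (v : 'cV[R]_n.+1) : norm2sq v = 1 ->
  exists H : 'M[R]_n.+1,
    [/\ H^T = H, H *m H = 1%:M & H *m delta_mx 0 0 = v].
Proof.
move=> v1; pose e : 'cV[R]_n.+1 := delta_mx 0 0; pose w := e - v.
have e1 : bform 1%:M e e = 1.
  by rewrite /bform mulmx1 trmx_delta mul_delta_mx mxE !eqxx.
(* If [v] is already [e], there is no hyperplane to reflect across and the identity serves. *)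
have [w0|w0] := eqVneq w 0.
  exists 1%:M; rewrite trmx1 mulmx1; split => //.
  by rewrite mul1mx; apply/eqP; rewrite -subr_eq0 -/e -/w w0.
have wp : 0 < norm2sq w by rewrite lt_def norm2sq_ge0 norm2sq_eq0 w0.
(* Since [e] and [v] are unit vectors, w'e and |w|^2 / 2 both equal 1 - e'v. *)
have we : (w^T *m e) = (norm2sq w / 2)%:M.
  apply/rowP => i; rewrite (ord1 i) [RHS]mxE eqxx mulr1n.
  rewrite -[w^T]mulmx1 -/(bform 1%:M w e) norm2sqE /w -[- v]scaleN1r.
  rewrite !(bformDl, bformDr) !(bformZl, bformZr).
  rewrite (bform_sym e v (trmx1 R n.+1)) e1 -(norm2sqE v) v1.
  by field.
have ww : w^T *m w = (norm2sq w)%:M.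
  by apply/rowP => i; rewrite (ord1 i) [RHS]mxE eqxx norm2sqE /bform mulmx1.
pose c := 2 / norm2sq w.
exists (1%:M - c *: (w *m w^T)); split.
- by rewrite linearB/= linearZ/= trmx1 trmx_mul trmxK.
- rewrite mulmxBl !mulmxBr !mul1mx mulmx1 -scalemxAl -scalemxAr.
  rewrite mulmxA -(mulmxA w) ww mul_mx_scalar -scalemxAl !scalerA.
  have -> : c * (c * norm2sq w) = c + c by rewrite /c; field; rewrite gt_eqF.
  by rewrite scalerDl opprB addrK subrK.
- rewrite mulmxBl mul1mx -scalemxAl -mulmxA we mul_mx_scalar scalerA.
  have -> : c * (norm2sq w / 2) = 1 by rewrite /c; field; rewrite gt_eqF.
  by rewrite scale1r /w opprB addrC subrK.
Qed.

(** Deflation: a reflection [Q] takes [e_0] to a unit eigenvector, so [Q S Q] has first column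
    [s e_0]; by symmetry it is block diagonal, and the induction hypothesis diagonalizes the lower
    block. *)
Lemma spectral_decomposition n (S : 'M[R]_n) : S^T = S ->
  exists (U : 'M[R]_n) (dg : 'rV[R]_n),
    U *m U^T = 1%:M /\ S = U *m diag_mx dg *m U^T.
Proof.
elim: n S => [|n IH] S sS.
  by exists 1%:M, 0; split; apply/matrixP => -[].
have [s /eigenvalueP[x xS x0] _] := exists_top_eigenvalue (ltn0Sn n) sS.
have xp : 0 < norm2sq x^T by rewrite lt_def norm2sq_ge0 norm2sq_eq0 trmx_eq0 x0.
pose v := (Num.sqrt (norm2sq x^T))^-1 *: x^T.
have v1 : norm2sq v = 1 by rewrite norm2sqZ exprVn sqr_sqrtr ?mulVf ?gt_eqF// ltW.
have Sv : S *m v = s *: v.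
  by rewrite -scalemxAr -sS -trmx_mul xS linearZ/= scalerA mulrC -scalerA.
have [Q [sQ QQ Qe]] := householder v1.
pose A : 'M[R]_(1 + n) := Q *m S *m Q.
have sA : A^T = A by rewrite !trmx_mul sQ sS mulmxA.
have Ae : A *m delta_mx 0 0 = s *: delta_mx 0 0 :> 'cV[R]_(1 + n).
  by rewrite -!mulmxA Qe Sv -scalemxAr -Qe mulmxA QQ mul1mx.
have SA : S = Q *m A *m Q by rewrite /A !mulmxA QQ mul1mx -mulmxA QQ mulmx1.
clearbody A.
have A0 i (j : 'I_1) : A i (lshift n j) = s * (i == lshift n j)%:R.
  have -> : lshift n j = 0 by apply: val_inj; rewrite /= ord1.
  have := congr1 (fun M : 'cV[R]_(1 + n) => M i 0) Ae.
  by rewrite -colE !mxE eqxx andbT.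
have AE : A = block_mx s%:M 0 0 (drsubmx A).
  rewrite -[LHS]submxK; congr block_mx; apply/matrixP => i j.
  - by rewrite !mxE A0 !ord1 !eqxx mulr1 mulr1n.
  - by rewrite -sA !mxE A0 eq_rlshift mulr0.
  - by rewrite !mxE A0 eq_rlshift mulr0.
have sdr : (drsubmx A)^T = drsubmx A by rewrite trmx_drsub sA.
have [U [dg [UU dE]]] := IH _ sdr.
pose V : 'M[R]_(1 + n) := block_mx 1%:M 0 0 U.
have VT : V^T = block_mx 1%:M 0 0 U^T by rewrite tr_block_mx trmx1 !trmx0.
have VV : V *m V^T = 1%:M.
  by rewrite VT mulmx_block !mulmx0 !mul0mx mulmx1 !addr0 add0r UU -scalar_mx_block.
exists (Q *m V), (row_mx s%:M dg); split.
  by rewrite trmx_mul sQ mulmxA -(mulmxA Q) VV mulmx1.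
have dE' : diag_mx (row_mx s%:M dg) = block_mx s%:M 0 0 (diag_mx dg) :> 'M[R]_(1 + n).
  by rewrite diag_mx_row; congr block_mx; apply/matrixP => i j; rewrite !ord1 !mxE.
have VdV : V *m diag_mx (row_mx s%:M dg) *m V^T = A.
  rewrite dE' AE VT !mulmx_block dE.
  by rewrite !(mulmx0, mul0mx, mul1mx, mulmx1, addr0, add0r).
by rewrite SA -VdV trmx_mul sQ !mulmxA.
Qed.

End quadratic_forms.

(** * Optimality conditions for the generalized Elastic Net *)

Section elastic_net.
Context {R : realType}.

Lemma ge0_limit (x c : R) : (forall e, 0 < e -> e <= 1 -> 0 <= x + c * e) -> 0 <= x.
Proof.
move=> h; rewrite leNgt; apply/negP => x0.
have c0 : 0 < `|c| + 1 by rewrite ltr_wpDl.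
(* At this [e] the term [c * e] is at most [- x / 2], so [x + c * e] is still negative. *)
pose e := Num.min 1 (- x / (2 * (`|c| + 1))).
have e0 : 0 < e by rewrite lt_min ltr01/= divr_gt0 ?oppr_gt0// mulr_gt0.
have e1 : e <= 1 by rewrite ge_min lexx.
have := h e e0 e1.
have : e * (2 * (`|c| + 1)) <= - x.
  by rewrite -ler_pdivlMr ?mulr_gt0// ge_min lexx orbT.
have := ler_norm c; nra.
Qed.

(** The hypothesis says that c t^2 - 2 t g + lam |b + t| is smallest at [t = 0]; the conclusion,
    that [g] is [lam / 2] times a subgradient of the absolute value at [b]. *)
Lemma abs_subgradient (c g lam b : R) : 0 <= lam ->
  (forall t, 0 <= c * t ^+ 2 - 2 * t * g + lam * (`|b + t| - `|b|)) ->
  `|g| <= lam / 2 /\ g * b = lam / 2 * `|b|.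
Proof.
move=> lam0 h.
have hg : `|g| <= lam / 2.
  (* Steps of length [e] in both directions: the penalty grows by at most [lam * e], and after
     division by [e] the quadratic term vanishes in the limit. *)
  have H s : `|s| = 1 -> 0 <= lam - 2 * s * g.
    move=> s1; apply: (@ge0_limit _ (c * s ^+ 2)) => e e0 _.
    rewrite -(pmulr_rge0 _ e0); apply: le_trans (h (e * s)) _.
    have : `|b + e * s| - `|b| <= e.
      by rewrite lerBlDl (le_trans (ler_normD _ _))// normrM s1 mulr1 gtr0_norm.
    nra.
  have := H 1 (normr1 _); have := H (-1) (normrN1 _).
  by rewrite ler_norml => ? ?; apply/andP; split; lra.
split=> //; apply/eqP; rewrite eq_le; apply/andP; split.
  by rewrite (le_trans (ler_norm _))// normrM ler_wpM2r.
suff : 0 <= 2 * g * b - lam * `|b| by lra.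
apply: (@ge0_limit _ (c * b ^+ 2)) => e e0 e1.
(* Shrinking [b] by the factor [1 - e] lowers the penalty by exactly lam e |b|, as [e <= 1]. *)
rewrite -(pmulr_rge0 _ e0); apply: le_trans (h (- (e * b))) _.
have -> : `|b - e * b| = (1 - e) * `|b|.
  by rewrite -{1}(mul1r b) -mulrBl normrM ger0_norm// subr_ge0.
by rewrite le_eqVlt; apply/orP; left; apply/eqP; ring.
Qed.

Lemma pd_unitmx n (S : 'M[R]_n) : sym_pd S -> S \in unitmx.
Proof.
move=> [sS pS]; rewrite -row_free_unit -kermx_eq0; apply/negPn/negP.
move=> /rowV0Pn[v /sub_kermxP vS v0].
by have := pS v^T; rewrite trmx_eq0 trmxK vS mul0mx mxE ltxx => /(_ v0).
Qed.

Lemma pd_psd n (S : 'M[R]_n) : sym_pd S -> psdmx S.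
Proof.
move=> [sS pS]; split=> // v; have [->|v0] := eqVneq v 0.
  by rewrite /bform mulmx0 mxE.
by apply: ltW; exact: pS.
Qed.

Lemma pd_inv n (S : 'M[R]_n) : sym_pd S -> psdmx (invmx S).
Proof.
move=> pS; have uS := pd_unitmx pS; have [sS S0] := pd_psd pS.
have sV : (invmx S)^T = invmx S by rewrite trmx_inv sS.
split=> // v; have := S0 (invmx S *m v).
by rewrite /bform trmx_mul sV -!mulmxA mulKVmx// mulmxA.
Qed.

(** [xget] picks a matrix built from some spectral decomposition; the spectral theorem shows that
    there is one, and the two facts hold for whichever is picked. *)
Lemma inv_sqrtmxP n (S : 'M[R]_n) : sym_pd S ->
  (inv_sqrtmx S)^T = inv_sqrtmx S /\
  inv_sqrtmx S *m S *m inv_sqrtmx S = 1%:M.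
Proof.
move=> [sS pS]; rewrite /inv_sqrtmx; set E := (X in xget 0 X).
have : E (xget 0 E).
  apply: xgetPex; have [U [dg [UU SE]]] := spectral_decomposition sS.
  have UTU := mulmx1C UU.
  eexists; exists U, dg; split; [exact: UU| |exact: SE|reflexivity].
  (* The entry [dg 0 i] is the quadratic form of [S] at the nonzero vector [U e_i]. *)
  move=> i; have : U *m delta_mx i 0 != 0 :> 'cV[R]_n.
    apply/eqP => /(congr1 (mulmx U^T)); rewrite mulmxA UTU mul1mx mulmx0.
    by move=> /matrixP/(_ i 0); rewrite !mxE !eqxx => /eqP; rewrite oner_eq0.
  move/pS; rewrite SE trmx_mul !mulmxA -(mulmxA _ U^T U) UTU mulmx1.
  rewrite -!mulmxA (mulmxA U^T) UTU mul1mx -colE trmx_delta -rowE.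
  by rewrite !mxE eqxx mulr1n.
move=> [U [dg [UU d0 SE ->]]]; have UTU := mulmx1C UU.
set D := map_mx _ dg; split.
  by rewrite !trmx_mul trmxK tr_diag_mx mulmxA.
rewrite {1}SE !mulmxA -(mulmxA _ U^T U) UTU mulmx1 -(mulmxA _ U^T U) UTU mulmx1.
rewrite -(mulmxA U) mulmx_diag -(mulmxA U) mulmx_diag.
rewrite (_ : diag_mx _ = 1%:M) ?mulmx1// -diag_const_mx; congr diag_mx.
apply/rowP => i; rewrite !mxE.
have s0 : Num.sqrt (dg 0 i) != 0 by rewrite gt_eqF// sqrtr_gt0.
by rewrite -{2}(sqr_sqrtr (ltW (d0 i))); field.
Qed.

(** The objective in the original coordinates [b = inv_sqrtmx S *m bt], where the l1 penalty is
    separable and |bt|^2 becomes b'Sb. *)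
Definition penalized_loss n p (X : 'M[R]_(n, p)) (y : 'cV[R]_n) (S : 'M[R]_p)
    (lam eta : R) (b : 'cV[R]_p) : R :=
  norm2sq (y - X *m b) + lam * norm1 b + eta * bform S b b.

Lemma gEN_objE n p (X : 'M[R]_(n, p)) y S lam eta bt : sym_pd S ->
  gEN_obj X y S lam eta bt =
  penalized_loss X y S lam eta (inv_sqrtmx S *m bt).
Proof.
move=> /inv_sqrtmxP[sT TST]; rewrite /gEN_obj /penalized_loss mulmxA.
congr (_ + _ * _); rewrite norm2sqE /bform mulmx1 trmx_mul sT -!mulmxA.
by rewrite [inv_sqrtmx S *m (S *m _)]mulmxA (mulmxA _ _ bt) TST mul1mx.
Qed.

Section optimality.
Variables (n p : nat) (X : 'M[R]_(n, p)) (y : 'cV[R]_n) (S : 'M[R]_p).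
Variables (lam eta : R).
Hypotheses (pdS : sym_pd S) (lam_gt0 : 0 < lam) (eta_gt0 : 0 < eta).

Let F := penalized_loss X y S lam eta.

(** A nonzero value cannot be the default of [xget], so it comes from a minimizer. *)
Lemma gEN_minimizer b : gEN X y S lam eta != 0 -> F (gEN X y S lam eta) <= F b.
Proof.
rewrite /gEN /gEN_tilde; case: xgetP => [bt _ min _|_]; last by rewrite mulmx0 eqxx.
have [sT TST] := inv_sqrtmxP pdS.
(* This vector is the preimage of [b] under [inv_sqrtmx S]. *)
have := min (S *m inv_sqrtmx S *m b); rewrite !gEN_objE//.
by rewrite !mulmxA TST mul1mx.
Qed.

(** The strict minimizer [b0] itself proves that the set given to [xget] is nonempty. *)
Lemma gEN_unique b0 : (forall b, b != b0 -> F b0 < F b) -> gEN X y S lam eta = b0.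
Proof.
move=> lt0; have [sT TST] := inv_sqrtmxP pdS.
have E : inv_sqrtmx S *m (S *m inv_sqrtmx S *m b0) = b0.
  by rewrite !mulmxA TST mul1mx.
have min0 b : F b0 <= F b.
  by have [->//|bb0] := eqVneq b b0; exact/ltW/lt0.
rewrite /gEN /gEN_tilde; case: xgetP => [bt _ min|]; last first.
  by move/(_ (S *m inv_sqrtmx S *m b0)) => []; move=> b; rewrite !gEN_objE// E.
have := min (S *m inv_sqrtmx S *m b0); rewrite !gEN_objE// E => h.
by apply/eqP/negPn/negP => /lt0; rewrite ltNge h.
Qed.

(* minus one half of the gradient of the smooth part of the penalized loss *)
Definition score b : 'cV[R]_p := X^T *m (y - X *m b) - eta *: (S *m b).

(** The smooth part is quadratic, so its second-order expansion is exact; apart from the quadratic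
    term, the increment is a sum over coordinates that can be treated one at a time. *)
Lemma penalized_lossD b h : F (b + h) =
  F b + (norm2sq (X *m h) + eta * bform S h h)
    + \sum_j (lam * (`|b j 0 + h j 0| - `|b j 0|) - 2 * h j 0 * score b j 0).
Proof.
have [sS _] := pdS; rewrite big_split/= sumrN.
have -> : \sum_j 2 * h j 0 * score b j 0 =
    2 * (bform 1%:M (X *m h) (y - X *m b) - eta * bform S h b).
  rewrite /bform mulmx1 trmx_mul -!mulmxA.
  have -> : (h^T *m (X^T *m (y - X *m b))) 0 0 - eta * (h^T *m (S *m b)) 0 0 =
      (h^T *m score b) 0 0.
    rewrite [in RHS]/score [in RHS]mulmxBr -scalemxAr [RHS]mxE [X in _ = _ + X]mxE.
    by rewrite [X in _ = _ - X]mxE.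
  rewrite [in RHS]mxE mulr_sumr; apply: eq_bigr => j _; rewrite -mulrA; congr (_ * (_ * _)).
  by rewrite mxE.
have -> : \sum_j lam * (`|b j 0 + h j 0| - `|b j 0|) =
    lam * (norm1 (b + h) - norm1 b).
  rewrite -mulr_sumr /norm1 -sumrB; congr (_ * _); apply: eq_bigr => j _.
  by rewrite mxE.
rewrite /F /penalized_loss !norm2sqE mulmxDr opprD addrA.
move: (y - X *m b) => r.
rewrite -[- (X *m h)]scaleN1r !(bformDl, bformDr) !(bformZl, bformZr).
rewrite (bform_sym b h sS) (bform_sym r (X *m h) (trmx1 R n)).
ring.
Qed.

(** Each summand of the expansion is nonnegative, because 2 score (b + h) <= lam |b + h| with
    equality at [h = 0]. The ridge term makes the increase strict, whatever the rank of [X]. *)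
Lemma KKT_sufficient b :
  (forall j, `|score b j 0| <= lam / 2) ->
  (forall j, score b j 0 * b j 0 = lam / 2 * `|b j 0|) ->
  gEN X y S lam eta = b.
Proof.
move=> h1 h2; apply: gEN_unique => b' bb'.
have -> : b' = b + (b' - b) by rewrite addrC subrK.
have h0 : b' - b != 0 by rewrite subr_eq0.
move: (b' - b) h0 => h h0; rewrite penalized_lossD -addrA ltrDl.
rewrite ltr_pwDl//.
  by rewrite ltr_wpDl ?norm2sq_ge0// mulr_gt0//; exact: pdS.2.
apply: sumr_ge0 => j _; have := h2 j; have := h1 j.
have : score b j 0 * (b j 0 + h j 0) <= `|score b j 0| * `|b j 0 + h j 0|.
  by rewrite -normrM ler_norm.
have := normr_ge0 (b j 0 + h j 0); nra.
Qed.

(** Moving only coordinate [j] reduces the claim to the one-dimensional [abs_subgradient]. *)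
Lemma KKT_necessary : gEN X y S lam eta != 0 ->
  let b := gEN X y S lam eta in
  forall j, `|score b j 0| <= lam / 2 /\ score b j 0 * b j 0 = lam / 2 * `|b j 0|.
Proof.
move=> b0 b j.
pose e : 'cV[R]_p := delta_mx j 0.
apply: (@abs_subgradient (norm2sq (X *m e) + eta * bform S e e)); first exact: ltW.
move=> t; have := gEN_minimizer (b + t *: e) b0; rewrite -/b penalized_lossD.
rewrite -addrA lerDl (bigD1 j)//= big1 => [|k kj]; last first.
  by rewrite !mxE (negbTE kj)/= !mulr0 addr0 subrr mulr0 mul0r subrr.
rewrite addr0 !mxE !eqxx mulr1 -scalemxAr norm2sqZ bformZl bformZr.
by congr (0 <= _); ring.
Qed.

End optimality.
End elastic_net.

(** * Sign recovery for a fixed design *)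

Section sign_recovery.
Context {R : realType}.

Lemma sgr_close (x b : R) : `|x - b| < `|b| -> Num.sg x = Num.sg b.
Proof.
case: (ltrgt0P b) => [b0|b0|->]; last by rewrite ltNge normr_ge0.
  by rewrite ltr_norml => /andP[h _]; rewrite !gtr0_sg//; lra.
by rewrite ltr_norml => /andP[_ h]; rewrite !ltr0_sg//; lra.
Qed.

(** Turns an equality of signs into a strict inequality, a form suited to measurability. *)
Lemma sgr_eq_mul_gt0 (x b : R) : b != 0 -> Num.sg x = Num.sg b <-> 0 < b * x.
Proof.
move=> b0; rewrite -sgr_cp0 sgrM; split=> [->|].
  by rewrite -expr2 sqr_sg b0.
by move=> /eqP h; rewrite -[RHS]mulr1 -h mulrA -expr2 sqr_sg b0 mul1r.
Qed.

Lemma sqr_le_norm (x y : R) : 0 <= y -> x ^+ 2 <= y ^+ 2 -> `|x| <= y.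
Proof. by move=> y0 xy; rewrite -(ler_pXn2r (n := 2)) ?nnegrE// real_normK ?num_real. Qed.

Lemma sqr_lt_norm (x y : R) : 0 <= y -> x ^+ 2 < y ^+ 2 -> `|x| < y.
Proof. by move=> y0 xy; rewrite -(ltr_pXn2r (n := 2)) ?nnegrE// real_normK ?num_real. Qed.

Lemma beta_min_le q (b : 'cV[R]_q) j : beta_min b <= `|b j 0|.
Proof. by rewrite /beta_min (bigD1 j)//= ge_min lexx. Qed.

Lemma beta_min_gt0 q (b : 'cV[R]_q) : (0 < q)%N -> (forall j, b j 0 != 0) ->
  0 < beta_min b.
Proof.
move=> q0 b0; apply: (big_ind (fun x => 0 < x)) => [|x y x0 y0|j _].
- rewrite /norm1 (bigD1 (Ordinal q0))//= ltr_pwDl ?normr_gt0//.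
  by apply: sumr_ge0.
- by rewrite lt_min x0 y0.
- by rewrite normr_gt0.
Qed.

Lemma diag_le_lambda_max n (A : 'M[R]_n) M i : A^T = A -> lambda_max A <= M ->
  A i i <= M.
Proof.
move=> sA /(lambda_max_leP _ (leq_ltn_trans (leq0n _) (ltn_ord i)) sA)/(_ (delta_mx i 0)).
rewrite norm2sqE /bform mulmx1 trmx_delta mul_delta_mx -rowE -colE !mxE !eqxx.
by rewrite mulr1.
Qed.

Lemma gram_lambda_max m n (H : 'M[R]_(m, n)) M e i : lambda_max (H *m H^T) <= M ->
  (H *m e) i 0 ^+ 2 <= M * norm2sq e.
Proof.
move=> hM; apply: le_trans (mulmx_cauchy_schwarz H e i) _.
rewrite ler_wpM2r ?norm2sq_ge0// diag_le_lambda_max//.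
by rewrite trmx_mul trmxK.
Qed.

Lemma psd_coord_lambda_max n (A : 'M[R]_n) M (v : 'cV[R]_n) i : psdmx A ->
  0 <= M -> lambda_max A <= M -> (A *m v) i 0 ^+ 2 <= M ^+ 2 * norm2sq v.
Proof.
move=> pA M0 hM; apply: le_trans (norm2sq_coord _ _) _.
apply: psd_norm_mulmx_le => //.
exact/(lambda_max_leP _ (leq_ltn_trans (leq0n _) (ltn_ord i)) pA.1).
Qed.

Section fixed_design.
Variables (n q r : nat) (X : 'M[R]_(n, q + r)) (S : 'M[R]_(q + r)).
Variables (lam eta : R) (b1 : 'cV[R]_q).
Hypotheses (n_gt0 : (0 < n)%N) (q_gt0 : (0 < q)%N).
Hypotheses (pdS : sym_pd S) (lam_gt0 : 0 < lam) (eta_gt0 : 0 < eta).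
Hypothesis b1_neq0 : forall j, b1 j 0 != 0.

Let X1 := lsubmx X.
Let X2 := rsubmx X.
Let S11 := ulsubmx S.
Let S21 := dlsubmx S.
Let C := Cn11 X S eta.
Let C21 := Cn21 X S eta.

Let nR_gt0 : 0 < n%:R :> R. Proof. by rewrite ltr0n. Qed.
Let nR_neq0 : n%:R != 0 :> R. Proof. by rewrite gt_eqF. Qed.

Lemma sym_pd_ulsubmx : sym_pd S11.
Proof.
have [sS pS] := pdS; split=> [|v v0]; first by rewrite /S11 trmx_ulsub sS.
have := pS (col_mx v 0).
rewrite -{1}(submxK S) tr_col_mx trmx0 mul_row_block !mul0mx !addr0 mul_row_col.
rewrite mulmx0 addr0; apply; apply: contra v0.
by move=> /eqP/(congr1 usubmx); rewrite col_mxKu raddf0 => ->.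
Qed.

(** The Gram part may be singular, as when [n < q]; the ridge part makes the sum definite, so
    [invmx C] is a true inverse for every outcome of the design. *)
Lemma sym_pd_Cn11 : sym_pd C.
Proof.
have [s11 p11] := sym_pd_ulsubmx; split=> [|v v0].
  rewrite /C /Cn11 linearD/= !linearZ/= trmx_mul trmxK.
  by congr (_ + _ *: _).
rewrite -/(bform C v v) bform_addm !bform_scalem bform_gram.
rewrite ltr_wpDl ?mulr_ge0 ?invr_ge0 ?norm2sq_ge0 ?ler0n//.
by rewrite mulr_gt0 ?divr_gt0//; exact: p11.
Qed.

Let uC : C \in unitmx. Proof. exact/pd_unitmx/sym_pd_Cn11. Qed.

Lemma scale_Cn11 : n%:R *: C = X1^T *m X1 + eta *: S11.
Proof.
by rewrite /C /Cn11 scalerDr !scalerA mulfV// scale1r mulrCA mulfV// mulr1.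
Qed.

Lemma scale_Cn21 : n%:R *: C21 = X2^T *m X1 + eta *: S21.
Proof.
by rewrite /C21 /Cn21 scalerDr !scalerA mulfV// scale1r mulrCA mulfV// mulr1.
Qed.

Lemma mulmx_design (b : 'cV[R]_q) : X *m col_mx b 0 = X1 *m b.
Proof. by rewrite -{1}(hsubmxK X) mul_row_col mulmx0 addr0. Qed.

Lemma score_support (y : 'cV[R]_n) (b : 'cV[R]_q) :
  score X y S eta (col_mx b 0) =
  col_mx (X1^T *m y - n%:R *: (C *m b)) (X2^T *m y - n%:R *: (C21 *m b)).
Proof.
rewrite /score mulmx_design -{1}(hsubmxK X) tr_row_mx mul_col_mx.
rewrite -{1}(submxK S) mul_block_col !mulmx0 !addr0 scale_col_mx opp_col_mx add_col_mx.
rewrite !scalemxAl scale_Cn11 scale_Cn21 !mulmxBr !mulmxDl.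
by rewrite !opprD !addrA !mulmxA.
Qed.

(** The stationarity equation on the support, solved with the signs prescribed to be those of [b1]:
    the candidate for the active block of the estimator. *)
Definition active_estimate (y : 'cV[R]_n) : 'cV[R]_q :=
  n%:R^-1 *: (invmx C *m (X1^T *m y - (lam / 2) *: sgv b1)).

Lemma score_active_eq0 y b :
  X1^T *m y - n%:R *: (C *m b) = (lam / 2) *: sgv b1 <-> b = active_estimate y.
Proof.
rewrite /active_estimate; split=> [<-|->].
  by rewrite opprB addrC subrK -scalemxAr mulKmx// scalerA mulVf// scale1r.
rewrite -scalemxAr mulKVmx// scalerA mulfV// scale1r.
by rewrite opprB addrC subrK.
Qed.

(* This exact characterization is what makes the sign recovery event measurable.
   Existence of a minimizer is not an issue: without one, [xget] yields [0],
   whose signs are wrong. *)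
Lemma sgv_gEN_iff y :
  sgv (gEN X y S lam eta) = sgv (col_mx b1 0) <->
  sgv (active_estimate y) = sgv b1 /\
  forall j, `|(X2^T *m y - n%:R *: (C21 *m active_estimate y)) j 0| <= lam / 2.
Proof.
split=> [sg|[sg dual]].
  have kktg := @KKT_necessary R n (q + r) X y S lam eta pdS lam_gt0.
  move: (gEN X y S lam eta) sg kktg => g sg kktg; pose g1 := usubmx g.
  have sgE i : Num.sg (g i 0) = Num.sg (col_mx b1 (0 : 'cV_r) i 0).
    by have /matrixP/(_ i 0) := sg; rewrite !mxE.
  have g1E i : g1 i 0 = g (lshift r i) 0 by rewrite mxE.
  have sg1 i : Num.sg (g1 i 0) = Num.sg (b1 i 0) by rewrite g1E sgE col_mxEu.
  have gE : g = col_mx g1 0.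
    rewrite -[LHS]vsubmxK; congr col_mx; apply/colP => i; rewrite !mxE.
    by apply/eqP; rewrite -sgr_eq0 sgE col_mxEd mxE sgr0.
  (* Some coordinate of [g] has the sign of a nonzero entry of [b1], so [g] is not the default value
     and the optimality conditions apply. *)
  have g0 : g != 0.
    apply: contra_neq (b1_neq0 (Ordinal q_gt0)) => g0; apply/eqP.
    by rewrite -sgr_eq0 -sg1 g1E g0 mxE sgr0.
  have := kktg g0; rewrite gE /= => kkt.
  have <- : g1 = active_estimate y.
    apply/score_active_eq0/colP => i; have [_] := kkt (lshift r i).
    rewrite score_support !col_mxEu => h; rewrite [RHS]mxE [X in _ = _ * X]mxE.
    have gi : g1 i 0 != 0 by rewrite -sgr_eq0 sg1 sgr_eq0.
    (* An absolute value is sign times value, so [g1 i 0] cancels from the complementarity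
       equation. *)
    by apply: (mulIf gi); rewrite h -sg1 normrEsg mulrA.
  split=> [|j]; first by apply/matrixP => i j; rewrite !mxE ord1 -g1E sg1.
  by have [+ _] := kkt (rshift q j); rewrite score_support col_mxEd.
have -> : gEN X y S lam eta = col_mx (active_estimate y) 0.
  have up : X1^T *m y - n%:R *: (C *m active_estimate y) = (lam / 2) *: sgv b1.
    exact/score_active_eq0.
  apply: KKT_sufficient => // j; rewrite score_support up.
    case: (split_ordP j) => k ->; rewrite ?col_mxEu ?col_mxEd//.
    rewrite !mxE normrM normr_sg b1_neq0 mulr1 ger0_norm//.
    by rewrite divr_ge0// ltW.
  case: (split_ordP j) => k ->; rewrite ?col_mxEu ?col_mxEd//.
    rewrite -sg [X in X * _ = _]mxE [X in _ * X * _ = _]mxE.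
    by rewrite normrEsg mulrA.
  by rewrite [X in _ * X]mxE [X in `|X|]mxE mulr0 normr0 mulr0.
by rewrite /sgv !map_col_mx; congr col_mx.
Qed.

Section additive_noise.
Variable e : 'cV[R]_n.
Let y := X *m col_mx b1 0 + e.

Let sqrt_nV2 : (Num.sqrt n%:R)^-1 * (Num.sqrt n%:R)^-1 = n%:R^-1 :> R.
Proof. by rewrite -invfM -expr2 sqr_sqrtr// ltW. Qed.

(** Substituting X1'X1 = n C - eta S11 in the closed form separates the truth, the noise, the l1
    bias and the ridge bias. *)
Lemma active_estimateE :
  active_estimate y = b1 + (Num.sqrt n%:R)^-1 *: (HA X S eta *m e)
    - ((lam / (2 * n%:R)) *: (invmx C *m sgv b1)
       + (eta / n%:R) *: (invmx C *m (S11 *m b1))).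
Proof.
rewrite /active_estimate /y mulmx_design /HA -scalemxAl scalerA sqrt_nV2.
have -> : X1^T *m (X1 *m b1 + e) =
    n%:R *: (C *m b1) - eta *: (S11 *m b1) + X1^T *m e.
  by rewrite mulmxDr mulmxA scalemxAl scale_Cn11 mulmxDl -scalemxAl addrK.
rewrite -(mulmxA (invmx C)) !(mulmxDr, mulmxBr, mulmxN) -!scalemxAr mulKmx//.
rewrite -/C -/X1 -/S11.
move: (invmx C *m (S11 *m b1)) (invmx C *m (X1^T *m e)) (invmx C *m sgv b1) => u v w.
by apply/colP => i; rewrite !mxE; field.
Qed.

(** The terms n C21 b1 cancel; the two biases multiplied by [C21], together with - eta S21 b1, form
    [lam / 2] times the irrepresentable vector. *)
Lemma inactive_scoreE :
  X2^T *m y - n%:R *: (C21 *m active_estimate y) =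
  (lam / 2) *: GIC_vec X S lam eta b1 - Num.sqrt n%:R *: (HB X S eta *m e).
Proof.
rewrite active_estimateE /y mulmx_design /HB /GIC_vec -/C -/C21 -/S11 -/S21.
have sn : Num.sqrt n%:R != 0 :> R by rewrite gt_eqF// sqrtr_gt0.
have -> : X2^T *m (X1 *m b1 + e) =
    n%:R *: (C21 *m b1) - eta *: (S21 *m b1) + X2^T *m e.
  by rewrite mulmxDr mulmxA scalemxAl scale_Cn21 mulmxDl -scalemxAl addrK.
rewrite /HA -[(_ *: _) *m e]scalemxAl -[(_ *: _) *m e in RHS]scalemxAl.
rewrite !scalerA sqrt_nV2 mulfV// scale1r -/C -/X1 -/X2.
rewrite !(mulmxDr, mulmxBr, mulmxDl, mulmxBl, mulmxN, mulNmx) -!scalemxAr.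
rewrite -!mulmxA !(scalerDr, scalerBr, scalerN) !scalerA.
rewrite mulfV// scale1r.
rewrite (_ : n%:R * (lam / (2 * n%:R)) = lam / 2); last by field.
rewrite (_ : n%:R * (eta / n%:R) = eta); last by field.
rewrite (_ : lam / 2 * (2 * eta / lam) = eta); last by field; rewrite gt_eqF.
apply/colP => i; rewrite !mxE; ring.
Qed.

Variables (M1 M2 M3 alpha sigma K : R).
Hypotheses (M1_gt0 : 0 < M1) (M2_gt0 : 0 < M2) (M3_gt0 : 0 < M3).
Hypotheses (alpha_gt0 : 0 < alpha) (sigma_gt0 : 0 < sigma).
Hypothesis K_le1 : M1 * (K * sigma ^+ 2) <= (beta_min b1 / 3) ^+ 2.
Hypothesis K_le3 : K <= 2 + Num.sqrt 2.
Hypothesis lam_lt : lam / n%:R < 2 * beta_min b1 / (3 * M2 * Num.sqrt q%:R).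
Hypothesis lam_ge :
  2 * Num.sqrt (2 + Num.sqrt 2) * Num.sqrt M3 * sigma / alpha <= lam / n%:R.
Hypothesis eta_lt :
  eta / n%:R < (3 * M2 * lambda_max S11)^-1 * (beta_min b1 / norm2 b1).

Hypothesis noise_lt : norm2sq e < n%:R * K * sigma ^+ 2.
Hypothesis HA_le : lambda_max (HA X S eta *m (HA X S eta)^T) <= M1.
Hypothesis C_le : lambda_max (invmx C) <= M2.
Hypothesis HB_le : lambda_max (HB X S eta *m (HB X S eta)^T) <= M3.
Hypothesis GIC_le : forall j, `|GIC_vec X S lam eta b1 j 0| <= 1 - alpha.

Let bmin_gt0 : 0 < beta_min b1. Proof. exact: beta_min_gt0. Qed.

Let noise_term j :
  `|((Num.sqrt n%:R)^-1 *: (HA X S eta *m e)) j 0| < beta_min b1 / 3.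
Proof.
apply: sqr_lt_norm; first by rewrite divr_ge0// ltW.
apply: lt_le_trans K_le1; rewrite mxE exprMn exprVn sqr_sqrtr ?ler0n//.
rewrite mulrC ltr_pdivrMr//.
apply: le_lt_trans (gram_lambda_max e j HA_le) _.
by rewrite -mulrA ltr_pM2l// mulrC mulrA.
Qed.

(** All signs are nonzero, so the squared norm of [sgv b1] is [q]: the origin of the square root of
    [q] in the bound on [lam]. *)
Let lasso_bias j :
  `|((lam / (2 * n%:R)) *: (invmx C *m sgv b1)) j 0| < beta_min b1 / 3.
Proof.
have q0 : 0 < Num.sqrt q%:R :> R by rewrite sqrtr_gt0 ltr0n.
have h : `|(invmx C *m sgv b1) j 0| <= M2 * Num.sqrt q%:R.
  apply: sqr_le_norm; first by rewrite mulr_ge0// ltW.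
  apply: le_trans (psd_coord_lambda_max _ _ (pd_inv sym_pd_Cn11) (ltW M2_gt0) C_le) _.
  rewrite exprMn sqr_sqrtr ?ler0n// ler_wpM2l ?sqr_ge0//.
  rewrite /norm2sq (eq_bigr (fun=> 1)) ?sumr_const ?card_ord// => i _.
  by rewrite mxE -real_normK ?num_real// normr_sg b1_neq0 expr1n.
rewrite mxE normrM ger0_norm ?divr_ge0 ?mulr_ge0 ?ltW//.
have l0 : 0 <= lam / (2 * n%:R) by rewrite divr_ge0 ?mulr_ge0 ?ltW.
apply: le_lt_trans (ler_wpM2l l0 h) _.
have -> : lam / (2 * n%:R) * (M2 * Num.sqrt q%:R) =
  (lam / n%:R) * (M2 * Num.sqrt q%:R / 2) by field.
rewrite -ltr_pdivlMr ?divr_gt0 ?mulr_gt0//; apply: lt_le_trans lam_lt _.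
by rewrite le_eqVlt; apply/orP; left; apply/eqP; field; rewrite !gt_eqF.
Qed.

Let ridge_bias j :
  `|((eta / n%:R) *: (invmx C *m (S11 *m b1))) j 0| < beta_min b1 / 3.
Proof.
(* The bound on [eta] has this eigenvalue in a denominator, to be cleared below. *)
have L0 : 0 < lambda_max S11.
  have b10 : b1 != 0.
    by apply: contra_neq (b1_neq0 (Ordinal q_gt0)) => ->; rewrite mxE.
  have := bform_lambda_max b1 q_gt0 sym_pd_ulsubmx.1.
  move/(lt_le_trans (sym_pd_ulsubmx.2 _ b10)).
  by rewrite pmulr_lgt0// lt_def norm2sq_eq0 b10 norm2sq_ge0.
have N0 : 0 < norm2 b1.
  rewrite sqrtr_gt0 lt_def norm2sq_ge0 norm2sq_eq0 andbT.
  by apply: contra_neq (b1_neq0 (Ordinal q_gt0)) => ->; rewrite mxE.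
have h : `|(invmx C *m (S11 *m b1)) j 0| <= M2 * lambda_max S11 * norm2 b1.
  apply: sqr_le_norm; first by rewrite !mulr_ge0// ltW.
  apply: le_trans (psd_coord_lambda_max _ _ (pd_inv sym_pd_Cn11) (ltW M2_gt0) C_le) _.
  rewrite -mulrA exprMn ler_wpM2l ?sqr_ge0// exprMn sqr_sqrtr ?norm2sq_ge0//.
  apply: psd_norm_mulmx_le (pd_psd sym_pd_ulsubmx) (ltW L0) _ => u.
  exact: bform_lambda_max sym_pd_ulsubmx.1.
rewrite mxE normrM ger0_norm ?divr_ge0 ?ltW//.
have l0 : 0 <= eta / n%:R by rewrite divr_ge0 ?ltW.
apply: le_lt_trans (ler_wpM2l l0 h) _.
rewrite -ltr_pdivlMr ?mulr_gt0//; apply: lt_le_trans eta_lt _.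
by rewrite le_eqVlt; apply/orP; left; apply/eqP; field; rewrite !gt_eqF.
Qed.

(** On the support, three errors each below a third of [beta_min] cannot flip a sign. Off the
    support, the irrepresentable part uses up at most [(1 - alpha) * (lam / 2)], which leaves
    [alpha * (lam / 2)] for the noise. *)
Lemma sign_recovery : sgv (gEN X y S lam eta) = sgv (col_mx b1 0).
Proof.
apply/sgv_gEN_iff; split.
  apply/matrixP => j k; rewrite ord1 [LHS]mxE [RHS]mxE; apply: sgr_close.
  apply: lt_le_trans (beta_min_le b1 j); rewrite active_estimateE.
  move: (noise_term j) (lasso_bias j) (ridge_bias j).
  move: (_ *: _) (_ *: _) (_ *: _) => u v w.
  rewrite !mxE !ltr_norml => /andP[? ?] /andP[? ?] /andP[? ?].
  by apply/andP; split; lra.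
move=> j; rewrite inactive_scoreE.
pose s := Num.sqrt (2 + Num.sqrt 2) : R.
have s2 : s ^+ 2 = 2 + Num.sqrt 2 by rewrite sqr_sqrtr// addr_ge0 ?sqrtr_ge0.
have s0 : 0 <= s := sqrtr_ge0 _.
(* Bounds the coordinates of sqrt n HB e, since |e|^2 < n K sigma^2 and K <= s^2. The lower bound on
   [lam] says precisely that [t <= alpha * (lam / 2)]. *)
pose t := n%:R * (s * Num.sqrt M3 * sigma).
have tlam : t <= alpha * (lam / 2).
  have : 2 * s * Num.sqrt M3 * sigma / alpha * alpha * n%:R <=
      lam / n%:R * alpha * n%:R by rewrite !ler_wpM2r// ltW.
  rewrite divfK ?gt_eqF// (mulrAC _ alpha) divfK// /t; lra.
have h : `|(Num.sqrt n%:R *: (HB X S eta *m e)) j 0| <= t.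
  apply: sqr_le_norm; first by rewrite !mulr_ge0 ?sqrtr_ge0 ?ltW.
  rewrite mxE /t !exprMn s2 !sqr_sqrtr ?ler0n ?(ltW M3_gt0)//.
  have := gram_lambda_max e j HB_le.
  have : M3 * norm2sq e <= M3 * (n%:R * (2 + Num.sqrt 2) * sigma ^+ 2).
    rewrite ler_pM2l// (le_trans (ltW noise_lt))// ler_wpM2r ?sqr_ge0//.
    by rewrite ler_wpM2l// ltW.
  move=> h1 h2; have := ler_wpM2l (ltW nR_gt0) (le_trans h2 h1); congr (_ <= _).
  ring.
move: h (GIC_le j); move: (_ *: (HB _ _ _ *m _)) (GIC_vec _ _ _ _ _) => u v.
rewrite !mxE !ler_norml.
have l2 : 0 < lam / 2 by rewrite divr_gt0.
by move=> /andP[? ?] /andP[? ?]; apply/andP; split; nra.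
Qed.

End additive_noise.
End fixed_design.
End sign_recovery.

(** * Gaussian moments *)

Section normal_moments.
Context {R : realType}.
Notation mu := (@lebesgue_measure R).

Lemma derivable_oo_LRcontinuousT (f : R -> R) (a b : R) :
  (forall x, derivable f x 1) -> derivable_oo_LRcontinuous f a b.
Proof.
move=> df; have cf : continuous f.
  by move=> x; apply: differentiable_continuous; apply/derivable1_diffP.
split; [by move=> *; exact: df|exact/cvg_at_right_filter/cf|exact/cvg_at_left_filter/cf].
Qed.
(** [normal_prob] is dominated by Lebesgue measure, and its Radon-Nikodym derivative agrees almost
    everywhere with [normal_pdf], as both have the same integral over every measurable set. *)
Lemma ge0_integral_normal_prob (m s : R) (f : measurableTypeR R -> \bar R) :
  (forall x, 0 <= f x)%E -> measurable_fun setT f ->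
  (\int[normal_prob m s]_x f x = \int[mu]_x (f x * (normal_pdf m s x)%:E))%E.
Proof.
move=> f0 mf.
have dom := @normal_prob_dominates R m s.
rewrite -(Radon_Nikodym_SigmaFinite.change_of_variables dom)//.
have intf := Radon_Nikodym_SigmaFinite.f_integrable dom.
apply: ae_eq_integral => //.
- by apply: emeasurable_funM => //; exact: (measurable_int mu).
- apply: emeasurable_funM => //; apply/measurable_EFinP.
  exact: measurable_normal_pdf.
- apply: ae_eqe_mul2l => /=; apply: integral_ae_eq => //=.
  + by apply/measurable_EFinP; exact: measurable_normal_pdf.
  + by move=> E _ mE; rewrite -Radon_Nikodym_SigmaFinite.f_integral.
Qed.

Variable s : R.
Hypothesis s_gt0 : 0 < s.
Let p := normal_pdf 0 s.

Let p_ge0 x : 0 <= p x. Proof. exact: normal_pdf_ge0. Qed.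

Let pE : p = (fun y => normal_peak s * expR (y ^+ 2 * - (s ^+ 2 *+ 2)^-1)).
Proof.
rewrite /p normal_pdfE ?gt_eqF//; apply/funext => y.
by rewrite /normal_fun subr0 mulNr mulrN.
Qed.

Lemma is_derive_normal_pdf0 (x : R) : is_derive x 1 p (- (x / s ^+ 2) * p x).
Proof.
rewrite pE; apply: is_derive_eq.
by rewrite /= !scaler0 ?addr0 ?add0r /GRing.scale/= ?mulr1; field; rewrite gt_eqF.
Qed.

(** For the boundary terms of the integrations by parts. Since e^y >= y^(k+1) / (k+1)!, the sequence
    is at most c / n^(k+1), hence at most c / n. *)
Lemma cvg_exprM_normal_pdf0 k :
  n%:R ^+ k.+1 * p n%:R @[n --> \oo] --> (0 : R).
Proof.
pose c := normal_peak s * k.+1`!%:R * (s ^+ 2 *+ 2) ^+ k.+1.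
have s2 : 0 < s ^+ 2 *+ 2 by rewrite pmulrn_lgt0// exprn_gt0.
have c0 : 0 <= c by rewrite !mulr_ge0 ?normal_peak_ge0// exprn_ge0// ltW.
rewrite -cvg_shiftS/=.
apply: (@squeeze_cvgr _ _ _ _ (fun=> 0) (fun n => c * harmonic n)); last 2 first.
- exact: cvg_cst.
- by rewrite -[X in _ --> X](mulr0 c); apply: cvgMl_tmp; exact: cvg_harmonic.
near=> n; rewrite mulr_ge0 ?exprn_ge0//=.
set x : R := n.+1%:R; have x1 : 1 <= x by rewrite ler1n.
have x0 : 0 < x by apply: lt_le_trans x1.
rewrite pE /c /harmonic -/x.
set e := expR _; pose y := x ^+ 2 / (s ^+ 2 *+ 2).
have y0 : 0 < y by rewrite divr_gt0// exprn_gt0.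
have eE : e = (expR y)^-1 by rewrite -expRN /e mulrN.
have ey : e <= k.+1`!%:R / y ^+ k.+1.
  rewrite eE -invf_div lef_pV2 ?posrE ?expR_gt0 ?divr_gt0 ?exprn_gt0 ?ltr0n ?fact_gt0//.
  by apply: le_trans (expR_ge1Dxn k (ltW y0)); rewrite lerDr.
apply: (@le_trans _ _ (x ^+ k.+1 * (normal_peak s * (k.+1`!%:R / y ^+ k.+1)))).
  by rewrite !ler_wpM2l ?exprn_ge0 ?normal_peak_ge0// ltW.
have -> : x ^+ k.+1 * (normal_peak s * (k.+1`!%:R / y ^+ k.+1)) =
    normal_peak s * k.+1`!%:R * (s ^+ 2 *+ 2) ^+ k.+1 * (x ^+ k.+1)^-1.
  have xk : x ^+ k.+1 != 0 by rewrite expf_neq0 ?gt_eqF.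
  have sk : (s ^+ 2 *+ 2) ^+ k.+1 != 0 by rewrite expf_neq0 ?gt_eqF.
  rewrite /y expr_div_n -exprM mulnC exprM; field.
  by rewrite xk.
rewrite ler_wpM2l// lef_pV2 ?posrE ?exprn_gt0//.
by rewrite exprS ler_peMr ?exprn_ege1// ltW.
Unshelve. all: by end_near. Qed.


Let continuous_p : continuous p.
Proof. by apply: continuous_normal_pdf; rewrite gt_eqF. Qed.

Let continuous_Xp k : continuous (fun x : R => x ^+ k * p x).
Proof. by move=> x; apply: cvgM; [exact: exprn_continuous|exact: continuous_p]. Qed.

(** Integration by parts of x^(k+1) against x p(x), the derivative of - s^2 p. *)
Let integral_itv_Xp k (b : R) : 0 < b ->
  (\int[mu]_(x in `[0%R, b]) (x ^+ k.+2 * p x)%:E =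
   (- s ^+ 2 * (b ^+ k.+1 * p b))%:E +
   (s ^+ 2 * k.+1%:R)%:E * \int[mu]_(x in `[0%R, b]) (x ^+ k * p x)%:E)%E.
Proof.
move=> b0.
have cX (c : R) j : continuous (fun x : R => c * x ^+ j).
  by move=> x; apply: cvgM; [exact: cvg_cst|exact: exprn_continuous].
have dX x : is_derive x (1 : R) (fun y : R => y ^+ k.+1) (k.+1%:R * x ^+ k).
  apply: DeriveDef; first exact: exprn_derivable.
  by rewrite exp_derive /GRing.scale/= mulr1.
have dG x : is_derive x (1 : R) (fun y : R => - s ^+ 2 * p y) (x * p x).
  have dp := is_derive_normal_pdf0 x.
  apply: is_derive_eq; rewrite /GRing.scale/= ?mulr0 ?addr0.
  by field; rewrite gt_eqF.
have := @integration_by_parts R (fun x => x ^+ k.+1) (fun x => - s ^+ 2 * p x)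
  (fun x => k.+1%:R * x ^+ k) (fun x => x * p x) 0 b b0.
have -> : (\int[mu]_(x in `[0%R, b]) (x ^+ k.+1 * (x * p x))%:E =
   \int[mu]_(x in `[0%R, b]) (x ^+ k.+2 * p x)%:E)%E.
  by apply: eq_integral => x _; rewrite mulrA -exprSr.
move=> ->; first last.
- by move=> x _; rewrite derive1E; apply: derive_val.
- by apply: derivable_oo_LRcontinuousT => x; apply: ex_derive; exact: dG.
- apply: continuous_subspaceT => x.
  by apply: cvgM; [exact: cvg_id|exact: continuous_p].
- by move=> x _; rewrite derive1E; apply: derive_val.
- by apply: derivable_oo_LRcontinuousT => x; apply: ex_derive; exact: dX.
- exact/continuous_subspaceT/cX.
rewrite expr0n/= mul0r subr0 mulrCA; congr (_ + _)%E.
rewrite -integralZl//; last first.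
  apply: continuous_compact_integrable; first exact: segment_compact.
  exact/continuous_subspaceT/continuous_Xp.
rewrite -mulN1e -integralZl//; last first.
  apply: continuous_compact_integrable; first exact: segment_compact.
  apply: continuous_subspaceT => x.
  by apply: cvgM; [exact: cX|apply: cvgM; [exact: cvg_cst|exact: continuous_p]].
by apply: eq_integral => x _; rewrite -!EFinM; congr EFin; ring.
Qed.

(** The moment recursion, as the limit of the identity over [0, n]. An even [k] keeps the integrands
    nonnegative on the whole line for monotone convergence. Started from the mass 1/2 of the half
    line, one application gives the second moment and two give the fourth. *)
Let integral_itvy_Xp k (c : R) : ~~ odd k ->
  (\int[mu]_(x in `[0%R, +oo[) (x ^+ k * p x)%:E = c%:E)%E ->
  (\int[mu]_(x in `[0%R, +oo[) (x ^+ k.+2 * p x)%:E = (s ^+ 2 * k.+1%:R * c)%:E)%E.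
Proof.
move=> ek hc.
have ge0 j : ~~ odd j -> forall x, 0 <= x ^+ j * p x.
  by move=> ej x; rewrite mulr_ge0// real_exprn_even_ge0// num_real.
have mXp j : measurable_fun setT (fun x : R => x ^+ j * p x).
  apply: continuous_measurable_fun; exact: continuous_Xp.
have ek2 : ~~ odd k.+2 by rewrite /= negbK.
have h1 := @ge0_cvgn_integral R mu _ (ge0 _ ek2) (mXp _).
have h0 := @ge0_cvgn_integral R mu _ (ge0 _ ek) (mXp _).
rewrite hc in h0.
suff h2 : (\int[mu]_(x in `[0%R, n%:R]) (x ^+ k.+2 * p x)%:E)%E @[n --> \oo] -->
    (s ^+ 2 * k.+1%:R * c)%:E by apply: (cvg_unique _ h1 h2).
rewrite -[(_ * c)%:E]add0e [(_ * c)%:E]EFinM.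
have h3 : ((- s ^+ 2 * (n%:R ^+ k.+1 * p n%:R))%:E + (s ^+ 2 * k.+1%:R)%:E *
    \int[mu]_(x in `[0%R, n%:R]) (x ^+ k * p x)%:E)%E @[n --> \oo] -->
    (0%:E + (s ^+ 2 * k.+1%:R)%:E * c%:E)%E.
  apply: cvgeD => //; last exact: cvgeZl.
  apply: cvg_EFin; first by near=> n.
  rewrite -[X in _ --> X](mulr0 (- s ^+ 2)).
  by apply: cvgMl_tmp; exact: cvg_exprM_normal_pdf0.
apply: cvg_trans h3; apply: near_eq_cvg; near=> n.
rewrite integral_itv_Xp// ltr0n; near: n; exact: nbhs_infty_gt.
Unshelve. all: by end_near. Qed.

Let integral_even_Xp k : ~~ odd k ->
  (\int[mu]_x (x ^+ k * p x)%:E =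
   2%:E * \int[mu]_(x in `[0%R, +oo[) (x ^+ k * p x)%:E)%E.
Proof.
move=> ek; rewrite ge0_symfun_integralT//.
- by congr (_ * integral _ _ _)%E; apply/seteqP; split => x/=; rewrite in_itv/= andbT.
- by move=> x; rewrite mulr_ge0// real_exprn_even_ge0// num_real.
- move=> x /=; rewrite exprNn -signr_odd (negbTE ek) expr0 mul1r.
  by rewrite pE sqrrN.
Qed.

Let integral_itvy_p : (\int[mu]_(x in `[0%R, +oo[) (x ^+ 0 * p x)%:E = (2^-1)%:E)%E.
Proof.
have := @integral_normal_pdf R 0 s.
have -> : (\int[mu]_x (normal_pdf 0 s x)%:E = \int[mu]_x (x ^+ 0 * p x)%:E)%E.
  by apply: eq_integral => x _; rewrite mul1r.
rewrite integral_even_Xp// => /(congr1 (fun z => ((2^-1)%:E * z)%E)).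
by rewrite muleA -EFinM mulVf// mul1e mule1.
Qed.

Lemma normal_moment2 : (\int[normal_prob 0 s]_x (x ^+ 2)%:E = (s ^+ 2)%:E)%E.
Proof.
rewrite ge0_integral_normal_prob; last 2 first.
- by move=> x; rewrite lee_fin sqr_ge0.
- by apply/measurable_EFinP; exact: measurable_funX.
under eq_integral do rewrite -EFinM.
rewrite integral_even_Xp// (integral_itvy_Xp _ integral_itvy_p)//.
by rewrite -EFinM; congr EFin; field.
Qed.

Lemma normal_moment4 :
  (\int[normal_prob 0 s]_x (x ^+ 4)%:E = (3 * s ^+ 4)%:E)%E.
Proof.
rewrite ge0_integral_normal_prob; last 2 first.
- by move=> x; rewrite lee_fin (exprM x 2 2) sqr_ge0.
- by apply/measurable_EFinP; exact: measurable_funX.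
under eq_integral do rewrite -EFinM.
rewrite integral_even_Xp// (integral_itvy_Xp _ (integral_itvy_Xp _ integral_itvy_p))//.
by rewrite -EFinM; congr EFin; field.
Qed.

End normal_moments.

(** * Concentration of the noise *)

Section gaussian_noise.
Context {R : realType} d (T : measurableType d) (P : probability T R).

Lemma ge0_integral_law (Z : T -> R) (s : R) (f : R -> R) :
  measurable_fun setT Z ->
  (forall A : set R, measurable A -> P (Z @^-1` A) = normal_prob 0 s A) ->
  (forall x, 0 <= f x) -> measurable_fun setT f ->
  (\int[P]_w (f (Z w))%:E = \int[normal_prob 0 s]_x (f x)%:E)%E.
Proof.
move=> mZ law f0 mf.
transitivity (\int[pushforward P (Z : T -> measurableTypeR R)]_x (f x)%:E)%E.
  apply/esym/(@ge0_integral_pushforward _ _ T (measurableTypeR R) R Z mZ P setT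
    (EFin \o f)) => //.
  - exact/measurable_EFinP.
  - by move=> x _; rewrite lee_fin.
by apply: eq_measure_integral => A mA _; apply: law.
Qed.

Variables (n : nat) (eps : T -> 'cV[R]_n) (sigma : R).
Hypothesis sigma_gt0 : 0 < sigma.
Hypothesis normal_eps :
  is_normal_vec P (fun w => (eps w)^T) 0 (sigma ^+ 2 *: 1%:M).

Let e i w : R := eps w i 0.

Lemma measurable_normal_coord i : measurable_fun setT (e i).
Proof.
have [me _] := normal_eps; have := me i.
by apply: eq_measurable_fun => w _; rewrite mxE.
Qed.
Let me := measurable_normal_coord.

(** A combination with |a| = c is N(0, sigma^2 c^2); [0 < c] ensures that [a] is nonzero, as
    [is_normal_vec] demands. *)
Lemma integral_normal_comb (a : 'rV[R]_n) (c : R) (f : R -> R) : 0 < c ->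
  (a *m a^T) 0 0 = c ^+ 2 ->
  (forall x, 0 <= f x) -> measurable_fun setT f ->
  (\int[P]_w (f (\sum_j a 0 j * e j w)%R)%:E =
   \int[normal_prob 0 (sigma * c)]_x (f x)%:E)%E.
Proof.
move=> c0 ac f0 mf; have [_ law] := normal_eps.
have E w : ((eps w)^T *m a^T) 0 0 = \sum_j a 0 j * e j w.
  by rewrite mxE; apply: eq_bigr => j _; rewrite !mxE mulrC.
have a0 : a != 0.
  apply: contraTneq c0 => a0; move: ac; rewrite a0 mul0mx mxE => /esym/eqP.
  by rewrite sqrf_eq0 => /eqP->; rewrite ltxx.
apply: (@ge0_integral_law (fun w => \sum_j a 0 j * e j w)) => //.
  by apply: measurable_sum => j; apply: measurable_funM.
move=> A mA; under eq_fun do rewrite -E.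
rewrite law// mul0mx mxE; congr (normal_prob _ _ A).
rewrite -scalemxAr mulmx1 -scalemxAl mxE ac -exprMn sqrtr_sqr ger0_norm//.
by rewrite mulr_ge0// ltW.
Qed.

Lemma integral_sqr_coord i : (\int[P]_w (e i w ^+ 2)%:E = (sigma ^+ 2)%:E)%E.
Proof.
rewrite -(normal_moment2 sigma_gt0).
have /= := @integral_normal_comb (delta_mx 0 i) 1 (fun x => x ^+ 2).
rewrite mulr1 => <-//.
- apply: eq_integral => w _; congr (_ ^+ 2)%:E.
  rewrite (bigD1 i)//= mxE !eqxx mul1r big1 ?addr0// => j ji.
  by rewrite mxE (negbTE ji) andbF mul0r.
- by rewrite trmx_delta mul_delta_mx mxE !eqxx expr1n.
- by move=> x; exact: sqr_ge0.
Qed.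

Lemma integral_exp4_coord i :
  (\int[P]_w (e i w ^+ 4)%:E = (3 * sigma ^+ 4)%:E)%E.
Proof.
rewrite -(normal_moment4 sigma_gt0).
have /= := @integral_normal_comb (delta_mx 0 i) 1 (fun x => x ^+ 4).
rewrite mulr1 => <-//.
- apply: eq_integral => w _; congr (_ ^+ 4)%:E.
  rewrite (bigD1 i)//= mxE !eqxx mul1r big1 ?addr0// => j ji.
  by rewrite mxE (negbTE ji) andbF mul0r.
- by rewrite trmx_delta mul_delta_mx mxE !eqxx expr1n.
- by move=> x; rewrite (exprM x 2 2) sqr_ge0.
Qed.

(** The combination has variance 2 sigma^2, and 3 (sqrt 2)^4 = 12. *)
Lemma integral_exp4_pair (t : R) i j : i != j -> t ^+ 2 = 1 ->
  (\int[P]_w ((e i w + t * e j w) ^+ 4)%:E = (12 * sigma ^+ 4)%:E)%E.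
Proof.
move=> ij t2; have s2 : 0 < (Num.sqrt 2 : R) by rewrite sqrtr_gt0.
have ji : j != i by rewrite eq_sym.
have := @normal_moment4 R (sigma * Num.sqrt 2) (mulr_gt0 sigma_gt0 s2).
have -> : 3 * (sigma * Num.sqrt 2) ^+ 4 = 12 * sigma ^+ 4.
  by rewrite exprMn (exprM (Num.sqrt _) 2 2) sqr_sqrtr//; ring.
move=> <-.
have /= := @integral_normal_comb (delta_mx 0 i + t *: delta_mx 0 j) (Num.sqrt 2)
  (fun x => x ^+ 4) s2.
move=> <-//.
- apply: eq_integral => w _; congr (_ ^+ 4)%:E.
  rewrite (bigD1 i)//= (bigD1 j)//= !mxE !eqxx/= (negbTE ij) (negbTE ji)/=.
  rewrite big1 ?addr0 ?add0r; first by ring.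
  by move=> k /andP[/negbTE ki /negbTE kj]; rewrite !mxE ki kj !andbF mulr0 addr0 mul0r.
- rewrite linearD/= linearZ/= !trmx_delta mulmxDl !mulmxDr -!scalemxAl -!scalemxAr.
  rewrite !mul_delta_mx !mul_delta_mx_0 ?(eq_sym j)// !mxE sqr_sqrtr//.
  by rewrite eqxx/= !mulr0 mulr1 -expr2 t2 addr0 add0r.
- by move=> x; rewrite (exprM x 2 2) sqr_ge0.
Qed.

(** Subtraction of integrals without presupposing that [f] is integrable: both functions are
    nonnegative and the total is finite, so additivity can be solved for the integral of [f]. *)
Let integral_EFinD (f g : T -> R) (a b c : R) :
  measurable_fun setT f -> measurable_fun setT g ->
  (forall w, 0 <= f w) -> (forall w, 0 <= g w) ->
  (\int[P]_w (g w)%:E = b%:E)%E -> (\int[P]_w (f w + g w)%:E = c%:E)%E ->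
  c = a + b -> (\int[P]_w (f w)%:E = a%:E)%E.
Proof.
move=> mf mg f0 g0 gb + cab.
under eq_integral do rewrite EFinD.
rewrite ge0_integralD//; last 4 first.
- by move=> w _; rewrite lee_fin.
- exact/measurable_EFinP.
- by move=> w _; rewrite lee_fin.
- exact/measurable_EFinP.
rewrite gb cab; case: (integral _ _ _) => //= x [] /eqP.
by rewrite (inj_eq (addIr _)) => /eqP ->.
Qed.

Let sqr4 (x : R) : 0 <= x ^+ 4. Proof. by rewrite (exprM x 2 2) sqr_ge0. Qed.

(* Only the laws of linear combinations are known, hence the polarization
   [(a + b)^4 + (a - b)^4 = 2 a^4 + 12 a^2 b^2 + 2 b^4]. *)
Lemma integral_sqr_pair i j : i != j ->
  (\int[P]_w (e i w ^+ 2 * e j w ^+ 2)%:E = (sigma ^+ 4)%:E)%E.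
Proof.
move=> ij.
have h1 := integral_exp4_pair ij (expr1n R 2).
have h2 : (\int[P]_w ((e i w + (-1) * e j w) ^+ 4)%:E = (12 * sigma ^+ 4)%:E)%E.
  by apply: integral_exp4_pair; rewrite // sqrrN expr1n.
have m4 k : measurable_fun setT (fun w => e k w ^+ 4) by exact: measurable_funX.
have mpm t : measurable_fun setT (fun w => (e i w + t * e j w) ^+ 4).
  by apply: measurable_funX; apply: measurable_funD => //; exact: measurable_funM.
have mp : measurable_fun setT (fun w => e i w ^+ 2 * e j w ^+ 2).
  by apply: measurable_funM; exact: measurable_funX.
have p0 w : 0 <= e i w ^+ 2 * e j w ^+ 2 by rewrite mulr_ge0 ?sqr_ge0.
(* Of 24 = 12 + 12, the two fourth powers take 6 each, and 12 is left for the mixed term. *)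
have h12 : (\int[P]_w ((e i w + 1 * e j w) ^+ 4 + (e i w + (-1) * e j w) ^+ 4)%:E
    = (24 * sigma ^+ 4)%:E)%E.
  under eq_integral do rewrite EFinD.
  rewrite ge0_integralD//; last 4 first.
  - by move=> w _; rewrite lee_fin.
  - exact/measurable_EFinP.
  - by move=> w _; rewrite lee_fin.
  - exact/measurable_EFinP.
  by rewrite h1 h2 -EFinD; congr EFin; ring.
have h3 : (\int[P]_w (12 * (e i w ^+ 2 * e j w ^+ 2) + 2 * e j w ^+ 4)%:E =
    (18 * sigma ^+ 4)%:E)%E.
  apply: (@integral_EFinD _ (fun w => 2 * e i w ^+ 4) _ (6 * sigma ^+ 4)
    (24 * sigma ^+ 4)).
  - by apply: measurable_funD; exact: measurable_funM.
  - exact: measurable_funM.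
  - by move=> w; apply: addr_ge0; apply: mulr_ge0.
  - by move=> w; apply: mulr_ge0.
  - under eq_integral do rewrite EFinM.
    rewrite ge0_integralZl//; last by move=> w _; rewrite lee_fin.
      by rewrite integral_exp4_coord -EFinM; congr EFin; ring.
    exact/measurable_EFinP.
  - by rewrite -h12; apply: eq_integral => w _; congr EFin; ring.
  - ring.
have h4 : (\int[P]_w (12 * (e i w ^+ 2 * e j w ^+ 2))%:E =
    (12 * sigma ^+ 4)%:E)%E.
  apply: (integral_EFinD _ _ _ _ _ h3 (b := 6 * sigma ^+ 4)).
  - exact: measurable_funM.
  - exact: measurable_funM.
  - by move=> w; apply: mulr_ge0.
  - by move=> w; apply: mulr_ge0.
  - under eq_integral do rewrite EFinM.
    rewrite ge0_integralZl//; last by move=> w _; rewrite lee_fin.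
      by rewrite integral_exp4_coord -EFinM; congr EFin; ring.
    exact/measurable_EFinP.
  - ring.
move: h4; under eq_integral do rewrite EFinM.
rewrite ge0_integralZl//; last 2 first.
- exact/measurable_EFinP.
- by move=> w _; rewrite lee_fin.
move/(congr1 (fun z => ((12^-1)%:E * z)%E)).
by rewrite muleA -!EFinM mulrA mulVf// mul1e mul1r.
Qed.

Let S w := norm2sq (eps w).

Lemma measurable_norm2sq_noise : measurable_fun setT S.
Proof. by apply: measurable_sum => i; apply: measurable_funX; exact: me. Qed.
Let mS := measurable_norm2sq_noise.

Let S_ge0 w : 0 <= S w. Proof. by apply: sumr_ge0 => i _; exact: sqr_ge0. Qed.

Let integral_S : (\int[P]_w (S w)%:E = (n%:R * sigma ^+ 2)%:E)%E.
Proof.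
under eq_integral do rewrite /S /norm2sq -sumEFin.
rewrite ge0_integral_sum//; last 2 first.
- by move=> i; apply/measurable_EFinP; apply: measurable_funX; exact: me.
- by move=> i w _; rewrite lee_fin sqr_ge0.
under eq_bigr do rewrite integral_sqr_coord.
by rewrite sumEFin sumr_const card_ord mulr_natl.
Qed.

Let integral_S2 :
  (\int[P]_w (S w ^+ 2)%:E = ((n%:R ^+ 2 + 2 * n%:R) * sigma ^+ 4)%:E)%E.
Proof.
have SE w : S w ^+ 2 = \sum_i \sum_j e i w ^+ 2 * e j w ^+ 2.
  by rewrite expr2 /S /norm2sq mulr_suml; apply: eq_bigr => i _; rewrite mulr_sumr.
have mij i j : measurable_fun setT (fun w => e i w ^+ 2 * e j w ^+ 2).
  by apply: measurable_funM; exact: measurable_funX.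
have gij i j w : 0 <= e i w ^+ 2 * e j w ^+ 2 by rewrite mulr_ge0// ?sqr_ge0.
under eq_integral do rewrite SE -sumEFin.
rewrite ge0_integral_sum//; last 2 first.
- by move=> i; apply/measurable_EFinP; exact: measurable_sum.
- by move=> i w _; rewrite lee_fin; exact: sumr_ge0.
(* The diagonal value exceeds the others by 2 sigma^4, which produces the [2 * n%:R] of the second
   moment. *)
have E i j : (\int[P]_w (e i w ^+ 2 * e j w ^+ 2)%:E =
    (sigma ^+ 4 + (2 * sigma ^+ 4) *+ (j == i))%:E)%E.
  have [->|ji] := eqVneq j i; last by rewrite addr0 integral_sqr_pair// eq_sym.
  under eq_integral do rewrite -exprD.
  by rewrite integral_exp4_coord; congr EFin; rewrite mulr1n; ring.
have E' i : (\int[P]_w (\sum_j e i w ^+ 2 * e j w ^+ 2)%:E =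
    (n%:R * sigma ^+ 4 + 2 * sigma ^+ 4)%:E)%E.
  under eq_integral do rewrite -sumEFin.
  rewrite ge0_integral_sum//; last 2 first.
  - by move=> j; exact/measurable_EFinP.
  - by move=> j w _; rewrite lee_fin.
  under eq_bigr do rewrite E.
  rewrite sumEFin big_split/= sumr_const card_ord (bigD1 i)//= eqxx mulr1n.
  by rewrite big1 ?addr0 ?mulr_natl// => j /negbTE ->.
under eq_bigr do rewrite E'.
by rewrite sumEFin sumr_const card_ord -mulr_natl; congr EFin; ring.
Qed.

(** In (S - m)^2 + 2 m S = S^2 + m^2 all terms are nonnegative, so [integral_EFinD] applies. *)
Let integral_variance_S :
  (\int[P]_w ((S w - n%:R * sigma ^+ 2) ^+ 2)%:E = (2 * n%:R * sigma ^+ 4)%:E)%E.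
Proof.
set m := n%:R * sigma ^+ 2.
have m0 : 0 <= m by rewrite mulr_ge0// ?sqr_ge0.
apply: (@integral_EFinD _ (fun w => 2 * m * S w) _ (2 * m ^+ 2)
    ((n%:R ^+ 2 + 2 * n%:R) * sigma ^+ 4 + m ^+ 2)).
- by apply: measurable_funX; exact: measurable_funB.
- exact: measurable_funM.
- by move=> w; exact: sqr_ge0.
- by move=> w; apply: mulr_ge0; [exact: mulr_ge0|exact: S_ge0].
- under eq_integral do rewrite EFinM.
  rewrite ge0_integralZl//; last 3 first.
  + exact/measurable_EFinP.
  + by move=> w _; rewrite lee_fin.
  + by rewrite lee_fin mulr_ge0.
  by rewrite integral_S -EFinM; congr EFin; rewrite /m; ring.
- transitivity (\int[P]_w ((S w ^+ 2)%:E + (m ^+ 2)%:E))%E.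
    by apply: eq_integral => w _; rewrite -EFinD; congr EFin; ring.
  rewrite ge0_integralD//; last 3 first.
  + by move=> w _; rewrite lee_fin sqr_ge0.
  + by apply/measurable_EFinP; exact: measurable_funX.
  + by move=> w _; rewrite lee_fin sqr_ge0.
  by rewrite integral_S2 integral_cst//= probability_setT mule1.
- by rewrite /m; ring.
Qed.

(** Chebyshev: on this event |eps|^2 exceeds its mean by at least n (K - 1) sigma^2, and its
    variance is 2 n sigma^4. *)
Lemma norm2sq_noise_tail (K : R) : (0 < n)%N -> 1 < K ->
  pr P [set w | n%:R * K * sigma ^+ 2 <= norm2sq (eps w)] <=
  2 / (K - 1) ^+ 2 * n%:R^-1.
Proof.
move=> n0 K1; set A := [set w | _].
have mA : measurable A.
  rewrite -[A]setTI; apply: measurable_fun_le => //.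
have K10 : 0 < K - 1 by rewrite subr_gt0.
have n0' : 0 < n%:R :> R by rewrite ltr0n.
pose c := (n%:R * (K - 1) * sigma ^+ 2) ^+ 2.
have c0 : 0 < c by rewrite exprn_gt0// !mulr_gt0// exprn_gt0.
have : (c%:E * P A <= (2 * n%:R * sigma ^+ 4)%:E)%E.
  rewrite -integral_variance_S -integral_cst//=.
  apply: (@le_trans _ _ (\int[P]_(w in A) ((S w - n%:R * sigma ^+ 2) ^+ 2)%:E)%E).
    apply: ge0_le_integral => //=.
    - by move=> w _; rewrite lee_fin ltW.
    - apply/measurable_EFinP/measurable_funTS.
      by apply: measurable_funX; exact: measurable_funB.
    - move=> w; rewrite /A/= => Aw; rewrite lee_fin /c lerXn2r ?nnegrE//.
      + by rewrite !mulr_ge0 ?sqr_ge0// ltW.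
      + apply: le_trans (_ : n%:R * (K - 1) * sigma ^+ 2 <= _).
          by rewrite !mulr_ge0 ?sqr_ge0// ltW.
        by move: Aw; rewrite /S; lra.
      + by move: Aw; rewrite /S; lra.
  apply: ge0_subset_integral => //.
  - by apply/measurable_EFinP; apply: measurable_funX; exact: measurable_funB.
  - by move=> w _; rewrite lee_fin sqr_ge0.
have [a Pa] : exists a, P A = a%:E.
  by exists (fine (P A)); rewrite fineK// fin_num_measure.
rewrite /pr Pa -EFinM lee_fin/= => h.
rewrite -(ler_pM2l c0) (le_trans h)// le_eqVlt; apply/orP; left; apply/eqP.
by rewrite /c; field; rewrite !gt_eqF.
Qed.

End gaussian_noise.

(** * Measurability of random matrices *)

Section random_matrices.
Context {R : realType} d (T : measurableType d).

Lemma measurable_inv : measurable_fun [set: R] (@GRing.inv R).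
Proof.
have E : [set: R] = [set x | x != 0] `|` [set 0].
  by apply/seteqP; split=> x //= _; have [->|] := eqVneq x 0; [right|left].
have o : open [set x : R | x != 0] by exact: open_neq.
rewrite E; apply/measurable_funU => //; first exact: open_measurable.
split; last exact: measurable_fun_set1.
apply: open_continuous_measurable_fun => // x; rewrite inE /= => x0.
exact: inv_continuous.
Qed.

Definition measurable_mx m n (A : T -> 'M[R]_(m, n)) : Prop :=
  forall i j, measurable_fun setT (fun w => A w i j).

Lemma measurable_mx_cst m n (A : 'M[R]_(m, n)) : measurable_mx (fun=> A).
Proof. by move=> i j; exact: measurable_cst. Qed.

Lemma measurable_mxD m n (A B : T -> 'M[R]_(m, n)) :
  measurable_mx A -> measurable_mx B -> measurable_mx (fun w => A w + B w).
Proof.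
move=> mA mB i j; apply: eq_measurable_fun (measurable_funD (mA i j) (mB i j)).
by move=> w _; rewrite mxE.
Qed.

Lemma measurable_mxZ m n c (A : T -> 'M[R]_(m, n)) :
  measurable_mx A -> measurable_mx (fun w => c *: A w).
Proof.
move=> mA i j.
apply: eq_measurable_fun (measurable_funM (measurable_cst c) (mA i j)).
by move=> w _; rewrite mxE.
Qed.

Lemma measurable_mxB m n (A B : T -> 'M[R]_(m, n)) :
  measurable_mx A -> measurable_mx B -> measurable_mx (fun w => A w - B w).
Proof.
move=> mA mB; apply: measurable_mxD => //.
by under eq_fun do rewrite -scaleN1r; exact: measurable_mxZ.
Qed.

Lemma measurable_mxM m n p (A : T -> 'M[R]_(m, n)) (B : T -> 'M[R]_(n, p)) :
  measurable_mx A -> measurable_mx B -> measurable_mx (fun w => A w *m B w).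
Proof.
move=> mA mB i j; have mAB : measurable_fun setT (fun w => \sum_k A w i k * B w k j).
  by apply: measurable_sum => k; apply: measurable_funM; [exact: mA|exact: mB].
by apply: eq_measurable_fun mAB => w _; rewrite mxE.
Qed.

Lemma measurable_lsubmx m n1 n2 (A : T -> 'M[R]_(m, n1 + n2)) :
  measurable_mx A -> measurable_mx (fun w => lsubmx (A w)).
Proof.
by move=> mA i j; apply: eq_measurable_fun (mA i (lshift n2 j)) => w _; rewrite mxE.
Qed.

Lemma measurable_rsubmx m n1 n2 (A : T -> 'M[R]_(m, n1 + n2)) :
  measurable_mx A -> measurable_mx (fun w => rsubmx (A w)).
Proof.
by move=> mA i j; apply: eq_measurable_fun (mA i (rshift n1 j)) => w _; rewrite mxE.
Qed.

Lemma measurable_trmx m n (A : T -> 'M[R]_(m, n)) :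
  measurable_mx A -> measurable_mx (fun w => (A w)^T).
Proof.
by move=> mA i j; apply: eq_measurable_fun (mA j i) => w _; rewrite mxE.
Qed.

Lemma measurable_det n (A : T -> 'M[R]_n) :
  measurable_mx A -> measurable_fun setT (fun w => \det (A w)).
Proof.
move=> mA; apply: measurable_sum => s; apply: measurable_funM => //.
by apply: measurable_prod => i _; exact: mA.
Qed.

(** Each entry is a cofactor over the determinant, both polynomial in the entries of [A]. *)
Lemma measurable_invmx n (A : T -> 'M[R]_n) : (forall w, A w \in unitmx) ->
  measurable_mx A -> measurable_mx (fun w => invmx (A w)).
Proof.
move=> uA mA i j.
have mdet : measurable_fun setT (fun w => (\det (A w))^-1).
  exact: measurableT_comp measurable_inv (measurable_det mA).
have mminor : measurable_fun setT (fun w => \det (row' j (col' i (A w)))).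
  apply: measurable_det => k l; apply: eq_measurable_fun (mA (lift j k) (lift i l)).
  by move=> w _; rewrite !mxE.
apply: eq_measurable_fun (measurable_funM mdet
  (measurable_funM (measurable_cst ((-1) ^+ (j + i) : R)) mminor)).
by move=> w _; rewrite /= /invmx uA !mxE.
Qed.

(* Reduces positivity of a quadratic form to countably many conditions: the
   vector [v] is approximated by [e * floor (v / e)] as [e] tends to [0]. *)
Lemma bform_ge0_int n (B : 'M[R]_n) :
  (forall z : 'cV[int]_n, 0 <= bform B (map_mx intr z) (map_mx intr z)) ->
  forall v, 0 <= bform B v v.
Proof.
move=> h v; pose L := norm1 v; pose c := abs_sum B.
have L0 : 0 <= L by apply: sumr_ge0.
have vL i : `|v i 0| <= L.
  by rewrite /L /norm1 (bigD1 i)//= lerDl; apply: sumr_ge0.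
have c0 : 0 <= c := abs_sum_ge0 B.
(* The cross terms contribute at most 2 c L e, and the quadratic one at most c e^2 <= c e. *)
apply: (@ge0_limit _ _ (c * (2 * L + 1))) => e e0 e1.
pose z : 'cV[int]_n := \col_i Num.floor (e^-1 * v i 0).
pose t : 'cV[R]_n := map_mx intr z - e^-1 *: v.
have t1 i : `|t i 0| <= 1.
  rewrite !mxE; have /andP[] := floor_itv (e^-1 * v i 0).
  by rewrite intrD ler_norml => ? ?; apply/andP; split; lra.
have b1 : `|bform B v t| <= c * L.
  apply: bform_abs_le => i j; rewrite normrM -[L]mulr1 ler_pM//.
have b2 : `|bform B t v| <= c * L.
  apply: bform_abs_le => i j; rewrite normrM -[L]mul1r ler_pM//.
have b3 : `|bform B t t| <= c * 1.
  by apply: bform_abs_le => i j; rewrite normrM mulr_ile1.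
have zE : map_mx intr z = e^-1 *: v + t by rewrite /t addrC subrK.
clearbody t.
have := h z; rewrite zE !bformDl !bformDr !bformZl !bformZr => h1.
have h2 : 0 <= bform B v v + e * (bform B v t + bform B t v) + e ^+ 2 * bform B t t.
  have := mulr_ge0 (sqr_ge0 e) h1; congr (_ <= _).  field.
  by rewrite gt_eqF.
apply: le_trans h2 _.
move: b1 b2 b3; rewrite !ler_norml => /andP[_ b1] /andP[_ b2] /andP[_ b3].
have : e * (bform B v t + bform B t v) <= e * (c * (2 * L)).
  by rewrite ler_wpM2l ?(ltW e0)//; lra.
have : e ^+ 2 * bform B t t <= e * c.
  by rewrite expr2 -mulrA ler_wpM2l ?(ltW e0)//; nra.
lra.
Qed.

(** The conditions on quadratic forms reduce to integer vectors by [bform_ge0_int], and these are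
    enumerated through [pickle]; a number that codes no vector imposes nothing. *)
Lemma measurable_lambda_max n (A : T -> 'M[R]_n) M : (0 < n)%N ->
  (forall w, (A w)^T = A w) -> measurable_mx A ->
  measurable [set w | lambda_max (A w) <= M].
Proof.
move=> n0 sA mA.
pose u (z : 'cV[int]_n) : 'cV[R]_n := map_mx intr z.
pose F k := if unpickle k is Some z
  then [set w | bform (A w) (u z) (u z) <= M * norm2sq (u z)] else setT.
have -> : [set w | lambda_max (A w) <= M] = \bigcap_k F k.
  apply/seteqP; split=> w /=.
    move/(lambda_max_leP _ n0 (sA w)) => h k _.
    by rewrite /F; case: unpickle => // z; exact: h.
  move=> h; apply/(lambda_max_leP _ n0 (sA w)) => v.
  have BE x : bform (M%:M - A w) x x = M * norm2sq x - bform (A w) x x.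
    by rewrite bform_addm bform_scalar -scaleN1r bform_scalem mulN1r.
  rewrite -subr_ge0 -BE; apply: bform_ge0_int => z.
  by rewrite BE subr_ge0; have := h (pickle z) I; rewrite /F pickleK.
apply: bigcapT_measurable => k; rewrite /F; case: unpickle => // z.
rewrite -[X in measurable X]setTI; apply: measurable_fun_le => //.
have : measurable_mx (fun w => (u z)^T *m A w *m u z).
  by do 2?apply: measurable_mxM => //; exact: measurable_mx_cst.
exact.
Qed.

End random_matrices.

(** * Consistency *)

Section probability_bounds.
Context {R : realType} d (T : measurableType d) (P : probability T R).
Implicit Types A B : set T.

Lemma EFin_pr A : measurable A -> P A = (pr P A)%:E.
Proof. by move=> mA; rewrite /pr fineK// fin_num_measure. Qed.

Lemma pr_le A B : measurable A -> measurable B -> A `<=` B -> pr P A <= pr P B.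
Proof.
move=> mA mB AB; rewrite -lee_fin -!EFin_pr//.
by apply: le_measure; rewrite ?inE.
Qed.

Lemma pr_le1 A : measurable A -> pr P A <= 1.
Proof. by move=> mA; rewrite -lee_fin -EFin_pr// probability_le1. Qed.

Lemma prC A : measurable A -> pr P (~` A) = 1 - pr P A.
Proof.
move=> mA; apply: EFin_inj; rewrite -EFin_pr; last exact: measurableC.
by rewrite probability_setC// EFin_pr// EFinB.
Qed.

(** The bounds [a] and [b] are left free so that the lemma iterates over nested intersections. *)
Lemma prI_ge A B a b : measurable A -> measurable B ->
  1 - pr P A <= a -> 1 - pr P B <= b -> 1 - pr P (A `&` B) <= a + b.
Proof.
move=> mA mB ha hb; rewrite -prC; last exact: measurableI.
rewrite setCI; apply: le_trans (lerD ha hb); rewrite -!prC//.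
have mAC := measurableC mA; have mBC := measurableC mB.
rewrite -lee_fin EFinD -!EFin_pr//; last exact: measurableU.
exact: measureU2.
Qed.

Lemma pr_forall_ge (I : finType) (A : I -> set T) :
  (forall i, measurable (A i)) ->
  measurable [set w | forall i, A i w] /\
  1 - pr P [set w | forall i, A i w] <= \sum_i (1 - pr P (A i)).
Proof.
move=> mA.
suff H (s : seq I) : measurable [set w | forall i, i \in s -> A i w] /\
    1 - pr P [set w | forall i, i \in s -> A i w] <= \sum_(i <- s) (1 - pr P (A i)).
  have -> : [set w | forall i, A i w] = [set w | forall i, i \in index_enum I -> A i w].
    by apply/seteqP; split=> w /= h i => [_|]; apply: h; rewrite mem_index_enum.
  exact: H.
elim: s => [|i s [ms IH]].
  rewrite big_nil (_ : [set w | _] = setT); last exact/seteqP.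
  by split=> //; rewrite /pr probability_setT subrr.
have -> : [set w | forall j, j \in i :: s -> A j w] =
    A i `&` [set w | forall j, j \in s -> A j w].
  apply/seteqP; split=> w /=.
    move=> h; split; first by apply: h; rewrite mem_head.
    by move=> j js; apply: h; rewrite inE js orbT.
  by move=> [hi hs] j; rewrite inE => /orP[/eqP->//|]; exact: hs.
split; first exact: measurableI.
by rewrite big_cons; apply: prI_ge.
Qed.

End probability_bounds.

Section limits.
Context {R : realType}.

(** The weight is at least 1, so the weighted sequence dominates [a]. *)
Lemma cvg0_of_expR_weight (a : nat -> R) (delta : R) :
  (\forall n \near \oo, 0 <= a n) ->
  (fun n => a n * expR (n%:R `^ delta)) @ \oo --> (0 : R) ->
  a @ \oo --> (0 : R).
Proof.
move=> a0 h; apply: (squeeze_cvgr _ (cvg_cst 0) h).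
near=> n; have an : 0 <= a n by near: n.
rewrite an/= ler_peMr// -expR0 ler_expR powR_ge0//.
Unshelve. all: by end_near. Qed.

End limits.

Theorem theorem1 (R : realType) (d : measure_display)
  (Omega : nat -> measurableType d) (P : forall n, probability (Omega n) R)
  (q : nat) (r : nat -> nat)
  (X : forall n, Omega n -> 'M[R]_(n, q + r n))
  (eps : forall n, Omega n -> 'cV[R]_n)
  (Sig : forall n, 'M[R]_(q + r n)) (sigma : R) (beta1 : 'cV[R]_q)
  (lam eta : nat -> R) (M1 M2 M3 alpha : R) :
  (0 < q)%N -> (forall n, (0 < r n)%N) ->
  (forall n, sym_pd (Sig n)) -> 0 < sigma ->
  (* rows of X i.i.d. N(0, Sigma), eps ~ N(0, sigma^2 I_n), eps independent of X *)
  (forall n (i : 'I_n), is_normal_vec (P n) (fun w => row i (X n w)) 0 (Sig n)) ->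
  (forall n, is_normal_vec (P n) (fun w => (eps n w)^T) 0 (sigma ^+ 2 *: 1%:M)) ->
  (forall n, indep_blocks (P n) (@Xeps_block n (q + r n))
                          (Xeps_coord (X n) (eps n))) ->
  (forall j, beta1 j 0 != 0) ->
  let bmin := beta_min beta1 in
  let betastar n : 'cV[R]_(q + r n) := col_mx beta1 0 in
  let y n w := X n w *m betastar n + eps n w in
  (forall delta : R, 0 < delta ->
     (fun n => ((q + r n)%N)%:R * expR (- (n%:R `^ delta))) @ \oo --> (0 : R)) ->
  0 < M1 -> 0 < M2 -> 0 < M3 -> 0 < alpha ->
  M1 < bmin ^+ 2 / (9 * sigma ^+ 2) ->
  Num.sqrt (2 + Num.sqrt 2) * Num.sqrt M3 * sigma / alpha
    < bmin / (3 * M2 * Num.sqrt q%:R) ->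
  (forall n, 0 < lam n) -> (forall n, 0 < eta n) ->
  (exists N, forall n, (N <= n)%N ->
     [/\ lam n / n%:R < 2 * bmin / (3 * M2 * Num.sqrt q%:R),
         lam n / n%:R >= 2 * Num.sqrt (2 + Num.sqrt 2) * Num.sqrt M3 * sigma / alpha &
         eta n / n%:R < (3 * M2 * lambda_max (ulsubmx (Sig n)))^-1
                        * (bmin / norm2 beta1)]) ->
  (* Generalized Irrepresentable Condition *)
  (exists delta4 : R, 0 < delta4 /\
     (fun n => (\big[Order.max/0]_(j < r n)
          pr (P n) [set w | `|GIC_vec (X n w) (Sig n) (lam n) (eta n) beta1 j 0|
                               > 1 - alpha])
        * expR (n%:R `^ delta4)) @ \oo --> (0 : R)) ->
  (exists delta1 : R, 0 < delta1 /\
     (fun n => (1 - pr (P n) [set w | lambda_max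
          (HA (X n w) (Sig n) (eta n) *m (HA (X n w) (Sig n) (eta n))^T) <= M1])
        * expR (n%:R `^ delta1)) @ \oo --> (0 : R)) ->
  (exists delta2 : R, 0 < delta2 /\
     (fun n => (1 - pr (P n) [set w | lambda_max
          (invmx (Cn11 (X n w) (Sig n) (eta n))) <= M2])
        * expR (n%:R `^ delta2)) @ \oo --> (0 : R)) ->
  (exists delta3 : R, 0 < delta3 /\
     (fun n => (1 - pr (P n) [set w | lambda_max
          (HB (X n w) (Sig n) (eta n) *m (HB (X n w) (Sig n) (eta n))^T) <= M3])
        * expR (n%:R `^ delta3)) @ \oo --> (0 : R)) ->
  (fun n => pr (P n) [set w |
      sgv (gEN (X n w) (y n w) (Sig n) (lam n) (eta n)) = sgv (betastar n)])
    @ \oo --> (1 : R).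
Proof.
move=> q0 r0 pdS s0 nX neps _ b0 bmin betastar y hp M1p M2p M3p ap M1b _ lam0 eta0.
move=> [N hN] [d4 [d4p h4]] [d1 [_ h1]] [d2 [_ h2]] [d3 [_ h3]].
have bmin0 : 0 < bmin by exact: beta_min_gt0.
(* The largest level that both the [HA] and the [HB] estimates tolerate. *)
pose K := Num.min (2 + Num.sqrt 2) (bmin ^+ 2 / (9 * sigma ^+ 2) / M1).
have K1 : 1 < K.
  rewrite lt_min ltr_pdivlMr// mul1r M1b andbT.
  by have := sqrtr_ge0 (2 : R); lra.
have KM1 : M1 * (K * sigma ^+ 2) <= (bmin / 3) ^+ 2.
  have : K <= bmin ^+ 2 / (9 * sigma ^+ 2) / M1 by rewrite ge_min lexx orbT.
  rewrite ler_pdivlMr// ler_pdivlMr ?mulr_gt0 ?exprn_gt0// expr_div_n; lra.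
have K3 : K <= 2 + Num.sqrt 2 by rewrite ge_min lexx.
pose EA n := [set w | lambda_max
          (HA (X n w) (Sig n) (eta n) *m (HA (X n w) (Sig n) (eta n))^T) <= M1].
pose EC n := [set w | lambda_max (invmx (Cn11 (X n w) (Sig n) (eta n))) <= M2].
pose EB n := [set w | lambda_max
          (HB (X n w) (Sig n) (eta n) *m (HB (X n w) (Sig n) (eta n))^T) <= M3].
pose gic n w := GIC_vec (X n w) (Sig n) (lam n) (eta n) beta1.
pose EG n := [set w | forall j, `|gic n w j 0| <= 1 - alpha].
pose EE n := [set w | norm2sq (eps n w) < n%:R * K * sigma ^+ 2].
pose mg n := \big[Order.max/0]_(j < r n) pr (P n) [set w | `|gic n w j 0| > 1 - alpha].
have mX n : measurable_mx (X n).
  move=> i j; have [+ _] := nX n i => /(_ j); apply: eq_measurable_fun => w _.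
  by rewrite mxE.
have meps n : measurable_mx (eps n).
  by move=> i j; rewrite ord1; exact: measurable_normal_coord (neps n) i.
have mX1 n := measurable_lsubmx (mX n).
have mX2 n := measurable_rsubmx (mX n).
have mC n : measurable_mx (fun w => Cn11 (X n w) (Sig n) (eta n)).
  apply: measurable_mxD; last exact: measurable_mx_cst.
  by apply: measurable_mxZ; apply: measurable_mxM => //; exact: measurable_trmx.
have mC21 n : measurable_mx (fun w => Cn21 (X n w) (Sig n) (eta n)).
  apply: measurable_mxD; last exact: measurable_mx_cst.
  by apply: measurable_mxZ; apply: measurable_mxM => //; exact: measurable_trmx.
(* At [n = 0] the inverse of [n%:R] is 0 and [Cn11] vanishes; hence the condition [0 < n] here and
   below. *)
have pdC n w : (0 < n)%N -> sym_pd (Cn11 (X n w) (Sig n) (eta n)).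
  by move=> n0; exact: sym_pd_Cn11.
have mCV n : (0 < n)%N ->
    measurable_mx (fun w => invmx (Cn11 (X n w) (Sig n) (eta n))).
  by move=> n0; apply: measurable_invmx => // w; exact/pd_unitmx/pdC.
have mHA n : (0 < n)%N -> measurable_mx (fun w => HA (X n w) (Sig n) (eta n)).
  move=> n0; apply: measurable_mxZ; apply: measurable_mxM; first exact: mCV.
  exact: measurable_trmx.
have mHB n : (0 < n)%N -> measurable_mx (fun w => HB (X n w) (Sig n) (eta n)).
  move=> n0; apply: measurable_mxZ; apply: measurable_mxB; last exact: measurable_trmx.
  apply: measurable_mxM; last exact: measurable_trmx.
  by apply: measurable_mxM => //; exact: mCV.
have mgic n : (0 < n)%N -> measurable_mx (gic n).
  move=> n0; apply: measurable_mxB; last exact: measurable_mx_cst.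
  apply: measurable_mxM; last exact: measurable_mx_cst.
  by apply: measurable_mxM => //; exact: mCV.
have sgram m k (H : 'M[R]_(m, k)) : (H *m H^T)^T = H *m H^T.
  by rewrite trmx_mul trmxK.
have mEA n : (0 < n)%N -> measurable (EA n).
  move=> n0; apply: measurable_lambda_max => //.
  by apply: measurable_mxM; [exact: mHA|exact/measurable_trmx/mHA].
have mEB n : (0 < n)%N -> measurable (EB n).
  move=> n0; apply: measurable_lambda_max => //.
  by apply: measurable_mxM; [exact: mHB|exact/measurable_trmx/mHB].
have mEC n : (0 < n)%N -> measurable (EC n).
  move=> n0; apply: measurable_lambda_max => //; last exact: mCV.
  by move=> w; exact: (pd_inv (pdC n w n0)).1.
have mGj n j : (0 < n)%N -> measurable [set w | `|gic n w j 0| <= 1 - alpha].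
  move=> n0; rewrite -[X in measurable X]setTI; apply: measurable_fun_le => //.
  by apply: measurableT_comp => //; exact: mgic.
have mEEC n : measurable [set w | n%:R * K * sigma ^+ 2 <= norm2sq (eps n w)].
  rewrite -[X in measurable X]setTI; apply: measurable_fun_le => //.
  exact: measurable_norm2sq_noise (neps n).
have EEC n : ~` EE n = [set w | n%:R * K * sigma ^+ 2 <= norm2sq (eps n w)].
  by apply/seteqP; split=> w /=; rewrite leNgt => /negP.
have mEE n : measurable (EE n).
  by rewrite -[EE n]setCK EEC; apply: measurableC; exact: mEEC.
pose ES n := [set w |
  sgv (gEN (X n w) (y n w) (Sig n) (lam n) (eta n)) = sgv (betastar n)].
have my n : measurable_mx (y n).
  apply: measurable_mxD => //; apply: measurable_mxM => //.
pose bh n w := active_estimate (X n w) (Sig n) (lam n) (eta n) beta1 (y n w).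
have mbh n : (0 < n)%N -> measurable_mx (bh n).
  move=> n0; apply: measurable_mxZ; apply: measurable_mxM; first exact: mCV.
  apply: measurable_mxB; last exact: measurable_mx_cst.
  by apply: measurable_mxM => //; exact: measurable_trmx.
have mES n : (0 < n)%N -> measurable (ES n).
  move=> n0; pose du n w := (rsubmx (X n w))^T *m y n w -
    n%:R *: (Cn21 (X n w) (Sig n) (eta n) *m bh n w).
  have iffS w := @sgv_gEN_iff R n q (r n) (X n w) (Sig n) (lam n) (eta n) beta1
    n0 q0 (pdS n) (lam0 n) (eta0 n) b0 (y n w).
  (* The choice operator disappears: what remains are finitely many inequalities on entries of
     measurable matrices. *)
  have -> : ES n = [set w | forall j, 0 < beta1 j 0 * bh n w j 0] `&`
      [set w | forall j, `|du n w j 0| <= lam n / 2].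
    apply/seteqP; split=> w.
      move=> /iffS[sg dual].
      split=> // j; rewrite -sgr_eq_mul_gt0//.
      by have /matrixP/(_ j 0) := sg; rewrite [LHS]mxE [RHS]mxE.
    move=> [sg dual]; apply/iffS.
    split=> //; apply/matrixP => j k; rewrite ord1 [LHS]mxE [RHS]mxE.
    by apply/sgr_eq_mul_gt0.
  have mdu : measurable_mx (du n).
    apply: measurable_mxB; first by apply: measurable_mxM => //; exact: measurable_trmx.
    by apply: measurable_mxZ; apply: measurable_mxM => //; exact: mbh.
  apply: measurableI.
    apply: (pr_forall_ge (P n) _).1 => j.
    rewrite -[X in measurable X]setCK; apply: measurableC.
    have -> : ~` [set w | 0 < beta1 j 0 * bh n w j 0] =
        [set w | beta1 j 0 * bh n w j 0 <= 0].
      by apply/seteqP; split=> w /=; rewrite leNgt => /negP.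
    rewrite -[X in measurable X]setTI; apply: measurable_fun_le => //.
    by apply: measurable_funM => //; exact: mbh.
  apply: (pr_forall_ge (P n) _).1 => j.
  rewrite -[X in measurable X]setTI; apply: measurable_fun_le => //.
  exact: measurableT_comp.
have sub n : (0 < n)%N -> (N <= n)%N ->
    EA n `&` (EC n `&` (EB n `&` (EG n `&` EE n))) `<=` ES n.
  move=> n0 /hN[c1 c2 c3] w [wA [wC [wB [wG wE]]]].
  exact: (@sign_recovery R n q (r n) (X n w) (Sig n) (lam n) (eta n) beta1
    n0 q0 (pdS n) (lam0 n) (eta0 n) b0 (eps n w) M1 M2 M3 alpha sigma K).
have bound n : (0 < n)%N -> (N <= n)%N -> 1 - pr (P n) (ES n) <=
    (1 - pr (P n) (EA n)) + ((1 - pr (P n) (EC n)) + ((1 - pr (P n) (EB n)) +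
      ((r n)%:R * mg n + 2 / (K - 1) ^+ 2 * n%:R^-1))).
  move=> n0 nN; have [mG hG] := pr_forall_ge (P n) (fun j => mGj n j n0).
  have hE : 1 - pr (P n) (EE n) <= 2 / (K - 1) ^+ 2 * n%:R^-1.
    apply: le_trans (norm2sq_noise_tail s0 (neps n) n0 K1).
    by rewrite -prC// EEC.
  have hG' : 1 - pr (P n) (EG n) <= (r n)%:R * mg n.
    apply: le_trans hG _; rewrite mulr_natl -[X in _ *+ X]card_ord -sumr_const.
    apply: ler_sum => j _; rewrite -prC; last exact: mGj.
    apply: le_trans (le_bigmax _ _ j); rewrite le_eqVlt; apply/orP; left; apply/eqP.
    congr (pr _ _); apply/seteqP; split=> w /=; last by rewrite ltNge => /negP.
    by move=> /negP; rewrite -ltNge.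
  have mGE : measurable (EG n `&` EE n) by exact: measurableI.
  have mBGE : measurable (EB n `&` (EG n `&` EE n)).
    by apply: measurableI => //; exact: mEB.
  have mCBGE : measurable (EC n `&` (EB n `&` (EG n `&` EE n))).
    by apply: measurableI => //; exact: mEC.
  have mall : measurable (EA n `&` (EC n `&` (EB n `&` (EG n `&` EE n)))).
    by apply: measurableI => //; exact: mEA.
  apply: (@le_trans _ _ (1 - pr (P n) (EA n `&` (EC n `&` (EB n `&` (EG n `&` EE n)))))).
    by rewrite lerD2l lerN2; apply: pr_le; [|exact: mES|exact: sub].
  apply: prI_ge => //; first exact: mEA.
  apply: prI_ge => //; first exact: mEC.
  apply: prI_ge => //; first exact: mEB.
  exact: prI_ge.
have mg0 n : 0 <= mg n by exact: bigmax_ge_id.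
have near_pos : \forall n \near \oo, (0 < n)%N by exact: nbhs_infty_gt.
have rateA : (fun n => 1 - pr (P n) (EA n)) @ \oo --> (0 : R).
  apply: cvg0_of_expR_weight h1; near=> n.
  by rewrite subr_ge0 pr_le1//; apply: mEA; near: n.
have rateC : (fun n => 1 - pr (P n) (EC n)) @ \oo --> (0 : R).
  apply: cvg0_of_expR_weight h2; near=> n.
  by rewrite subr_ge0 pr_le1//; apply: mEC; near: n.
have rateB : (fun n => 1 - pr (P n) (EB n)) @ \oo --> (0 : R).
  apply: cvg0_of_expR_weight h3; near=> n.
  by rewrite subr_ge0 pr_le1//; apply: mEB; near: n.
(* The growth condition on the dimension is taken at the exponent [d4] of the irrepresentable
   condition, so that the two exponential weights cancel. *)
have rateG : (fun n => (r n)%:R * mg n) @ \oo --> (0 : R).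
  have lim0 : (fun n => ((q + r n)%N)%:R * expR (- (n%:R `^ d4)) *
      (mg n * expR (n%:R `^ d4))) @ \oo --> (0 * 0 : R).
    by apply: cvgM; [exact: hp|exact: h4].
  rewrite mulr0 in lim0.
  apply: (squeeze_cvgr _ (cvg_cst 0) lim0); near=> n.
  rewrite mulr_ge0//= mulrACA expRN mulVf ?mulr1 ?gt_eqF ?expR_gt0//.
  by rewrite ler_wpM2r// ler_nat leq_addl.
have rateE : (fun n => 2 / (K - 1) ^+ 2 * n%:R^-1) @ \oo --> (0 : R).
  have lim0 : (fun n => 2 / (K - 1) ^+ 2 * harmonic n) @ \oo -->
      (2 / (K - 1) ^+ 2 * 0 : R) by apply: cvgMl_tmp; exact: cvg_harmonic.
  by rewrite mulr0 in lim0; rewrite -cvg_shiftS; exact: lim0.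
have low : (fun n => 1 - ((1 - pr (P n) (EA n)) + ((1 - pr (P n) (EC n)) +
    ((1 - pr (P n) (EB n)) + ((r n)%:R * mg n + 2 / (K - 1) ^+ 2 * n%:R^-1)))))
    @ \oo --> (1 - (0 + (0 + (0 + (0 + 0)))) : R).
  by apply: cvgB; [exact: cvg_cst|do 4?apply: cvgD].
rewrite !addr0 subr0 in low.
apply: (squeeze_cvgr _ low (cvg_cst (1 : R))); near=> n.
have n0 : (0 < n)%N by near: n.
apply/andP; split; last by rewrite pr_le1//; exact: mES.
rewrite /= lerBlDr -lerBlDl; apply: bound => //.
near: n; exact: nbhs_infty_ge.
Unshelve. all: by end_near. Qed.
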